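(* Let $X=T(\mathcal{F}_0,(\theta_n,\mathcal{F}_n)_{n=1}^\infty)$ where $(\mathcal{F}_n)_{n\ge0}$ are regular families with $\mathcal{S}_0\subseteq\mathcal{F}_n$ for all $n\ge0$, $\bigcup_n\mathcal{F}_n$ regular, $(\theta_n)$ nonincreasing null in $(0,1)$, $\alpha_n=\iota(\mathcal{F}_n)$ with $\alpha_n>1$ for $n\ge1$ and $(\alpha_n)_{n\ge1}$ nondecreasing, and $\alpha=\sup_{n\in\mathbb{N}}\alpha_n$. Then: (1) $\alpha_0\cdot\sup_{n\in\mathbb{N}}\alpha_n^\omega\le I_b(X)\le(\alpha_0\vee\alpha)\cdot\sup_{n\in\mathbb{N}}\alpha_n^\omega$. (2) If $\alpha_0\ge\alpha$, then $I_b(X)=\alpha_0\cdot\sup_{n\in\mathbb{N}}\alpha_n^\omega$. (3) If $\alpha_0<\alpha$ and $\alpha=\alpha_n$ for some $n\in\mathbb{N}$, then $I_b(X)=\alpha^\omega$. (4) If $\alpha_n<\alpha$ for all $n\in\mathbb{N}\cup\{0\}$ and $\alpha$ is not of the form $\omega^{\omega^\xi}$ with $\xi<\omega_1$, then $I_b(X)=\alpha^\omega$.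
   Context: Regular family: hereditary, spreading, compact subset of $[\mathbb{N}]^{<\infty}\subseteq2^{\mathbb{N}}$. $\mathcal{S}_0=\{\{n\}\}\cup\{\emptyset\}$. Mixed Tsirelson space: completion of $c_{00}$ under the norm implicitly defined by $\|x\|=\max\{\|x\|_{\mathcal{F}_0},\sup_n\sup\theta_n\sum_i\|E_ix\|\}$ with $\|\sum a_ke_k\|_{\mathcal{F}}=\sup_{F\in\mathcal{F}}\sum_{k\in F}|a_k|$, $Ex$ the restriction of $x$ to $E$, and the inner sup over $E_1<\dots<E_k$ ($\max E_i<\min E_{i+1}$) with $\{\min E_i\}\in\mathcal{F}_n$. $\iota(\mathcal{F})$: the ordinal $\beta$ with $\mathcal{F}^{(\beta)}=\{\emptyset\}$ (iterated Cantor–Bendixson derived sets). $\vee$ = maximum; ordinal arithmetic. $I_b(E)=\sup_{K\ge1}I_b(E,K)$, where $I_b(E,K)$ is the supremum of $o(T)$ over $\ell^1$-$K$ block trees $T$: trees on the unit sphere (sets of finite sequences closed under initial segments) whose nodes $(x_1,\dots,x_n)$ are finite block bases of the unit vector basis with $\|\sum a_ix_i\|\ge K^{-1}\sum|a_i|$ for all scalars; $o(T)$ is the least $\beta$ with $D^\beta(T)=\emptyset$, where $D(T)$ is the set of nodes with a proper extension in $T$, iterated transfinitely (intersections at limits). *)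

(* Defs.v *)
From HB Require Import structures.
From mathcomp Require Import all_boot all_order all_algebra.
From mathcomp Require Import reals.
Set Implicit Arguments. Unset Strict Implicit. Unset Printing Implicit Defensive.
Import Order.TTheory GRing.Theory Num.Theory.
Local Open Scope ring_scope.

(* Countable ordinals as Brouwer trees, compared up to the order Ole.  *)
(* Interpretation: OZ = 0, OS a = a+1, OL f = sup_n f n.              *)
Inductive Ord : Type := OZ | OS of Ord | OL of (nat -> Ord).

Inductive Ole : Ord -> Ord -> Prop :=
| Ole_Z b : Ole OZ b
| Ole_SS a b : Ole a b -> Ole (OS a) (OS b)
| Ole_Sr a b : Ole a b -> Ole a (OS b)
| Ole_Ll f b : (forall n, Ole (f n) b) -> Ole (OL f) b
| Ole_Lr a f n : Ole a (f n) -> Ole a (OL f).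

Definition Olt (a b : Ord) : Prop := Ole (OS a) b.
Definition Oeq (a b : Ord) : Prop := Ole a b /\ Ole b a.

Fixpoint ofnat (n : nat) : Ord := if n is k.+1 then OS (ofnat k) else OZ.
Definition omega : Ord := OL ofnat.
Definition omax (a b : Ord) : Ord := OL (fun n => if n is 0 then a else b).

Fixpoint oadd (a b : Ord) : Ord :=
  match b with OZ => a | OS b' => OS (oadd a b') | OL f => OL (fun n => oadd a (f n)) end.
Fixpoint omul (a b : Ord) : Ord :=
  match b with OZ => OZ | OS b' => oadd (omul a b') a | OL f => OL (fun n => omul a (f n)) end.
(* ordinal exponentiation; correct for bases >= 1 (only such bases are used) *)
Fixpoint oexp (a b : Ord) : Ord :=
  match b with OZ => OS OZ | OS b' => omul (oexp a b') a | OL f => OL (fun n => oexp a (f n)) end.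

(* Families of subsets of N, as subsets of 2^N = nat -> bool.          *)
Definition fam := (nat -> bool) -> Prop.

Definition finset_nat (A : nat -> bool) : Prop := exists m, forall k, (m <= k)%N -> A k = false.

Definition hereditary (G : fam) : Prop :=
  forall A B : nat -> bool, G A -> (forall k, B k -> A k) -> G B.

Definition spreading (G : fam) : Prop :=
  forall (A B : nat -> bool) (s t : seq nat),
    sorted ltn s -> sorted ltn t -> size s = size t ->
    (forall i, (i < size s)%N -> (nth 0 s i <= nth 0 t i)%N) ->
    (forall k, A k = (k \in s)) -> (forall k, B k = (k \in t)) ->
    G A -> G B.

(* closed (hence compact) in the product topology of 2^N *)
Definition closed_fam (G : fam) : Prop :=
  forall A : nat -> bool,
    (forall m, exists B, G B /\ forall k, (k < m)%N -> B k = A k) -> G A.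

Definition regular (G : fam) : Prop :=
  [/\ forall A, G A -> finset_nat A, hereditary G, spreading G & closed_fam G].

Definition S0_sub (G : fam) : Prop :=
  G (fun _ => false) /\ forall n, G (fun k => k == n).

Definition cb_deriv (G : fam) : fam := fun A =>
  G A /\ forall m, exists B, G B /\ (exists k, B k != A k) /\ forall k, (k < m)%N -> B k = A k.

Fixpoint cb_iter (b : Ord) (G : fam) : fam :=
  match b with
  | OZ => G
  | OS b' => cb_deriv (cb_iter b' G)
  | OL f => fun A => forall n, cb_iter (f n) G A
  end.

Definition iota_is (G : fam) (b : Ord) : Prop :=
  forall A, cb_iter b G A <-> (forall k, A k = false).

Section MT.
Variable R : realType.

Definition vec := nat -> R.
Definition zv : vec := fun _ => 0.
Definition finsupp (x : vec) : Prop := exists m, forall k, (m <= k)%N -> x k = 0.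

Definition restrict (E : seq nat) (x : vec) : vec := fun k => if k \in E then x k else 0.
Definition smin (s : seq nat) : nat := foldr minn (head 0%N s) s.
Definition set_lt (A B : seq nat) : bool := all (fun a => all (fun b => a < b)%N B) A.
Definition blocks (E : seq (seq nat)) : bool := all (fun s => s != [::]) E && sorted set_lt E.
Definition admissible (G : fam) (E : seq (seq nat)) : Prop :=
  blocks E /\ G (fun k => k \in map smin E).

(* the set whose supremum defines ||x|| (max of the two sups = sup of union) *)
Definition normset (F : nat -> fam) (theta : nat -> R) (N : vec -> R) (x : vec) : R -> Prop :=
  fun r =>
    (exists (A : nat -> bool) (m : nat), F 0%N A /\ r = \sum_(k < m | A k) `|x k|)
    \/ (exists (n : nat) (E : seq (seq nat)),
          (0 < n)%N /\ admissible (F n) E /\ r = theta n * \sum_(e <- E) N (restrict e x)).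

Definition isLUB (S : R -> Prop) (r : R) : Prop :=
  (forall s, S s -> s <= r) /\ (forall u, (forall s, S s -> s <= u) -> r <= u).

(* N is the norm of T(F_0,(theta_n,F_n)) restricted to c00 *)
Definition MTnorm (F : nat -> fam) (theta : nat -> R) (N : vec -> R) : Prop :=
  N zv = 0 /\ forall x, finsupp x -> isLUB (normset F theta N x) (N x).

Definition l1_block_node (N : vec -> R) (K : R) (xs : seq vec) : Prop :=
  [/\ forall i, (i < size xs)%N -> finsupp (nth zv xs i) /\ N (nth zv xs i) = 1,
      forall i j k, (i.+1 < size xs)%N -> nth zv xs i j != 0 -> nth zv xs i.+1 k != 0 -> (j < k)%N
    & forall a : nat -> R,
        K^-1 * \sum_(i < size xs) `|a i| <= N (fun k => \sum_(i < size xs) a i * nth zv xs i k)].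

Definition l1_tree (N : vec -> R) (K : R) (T : seq vec -> Prop) : Prop :=
  (forall s, T s -> l1_block_node N K s) /\ (forall s i, T s -> T (take i s)).

Definition treeD (T : seq vec -> Prop) : seq vec -> Prop := fun s =>
  T s /\ exists t, T t /\ (size s < size t)%N /\ take (size s) t = s.

Fixpoint treeD_iter (b : Ord) (T : seq vec -> Prop) : seq vec -> Prop :=
  match b with
  | OZ => T
  | OS b' => treeD (treeD_iter b' T)
  | OL f => fun s => forall n, treeD_iter (f n) T s
  end.

(* I_b(X) <= g : every l1-K block tree T (K>=1) has o(T) <= g, i.e. D^g(T) = empty *)
Definition Ib_le (N : vec -> R) (g : Ord) : Prop :=
  forall (K : R) (T : seq vec -> Prop), 1 <= K -> l1_tree N K T -> forall s, ~ treeD_iter g T s.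
(* I_b(X) >= g : for every d < g some l1-K block tree has o(T) > d *)
Definition Ib_ge (N : vec -> R) (g : Ord) : Prop :=
  forall d, Olt d g -> exists (K : R) (T : seq vec -> Prop),
      1 <= K /\ l1_tree N K T /\ exists s, treeD_iter d T s.
Definition Ib_eq (N : vec -> R) (g : Ord) : Prop := Ib_le N g /\ Ib_ge N g.
End MT.

(* Main.v *)
Require Import Defs.
From HB Require Import structures.
From mathcomp Require Import all_boot all_order all_algebra.
From mathcomp Require Import boolp reals.
From mathcomp Require Import ring lra zify.
Set Implicit Arguments. Unset Strict Implicit. Unset Printing Implicit Defensive.
Import Order.TTheory GRing.Theory Num.Theory.
Local Open Scope ring_scope.

(** Lower estimate: the unit vectors indexed by a set in the [k]-fold
    composition [F_n[F_n[...[F_0]]]] are [theta_n ^ -k]-equivalent to the [l1]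
    basis, and that family has index [alpha_0 * alpha_n ^ k].

    Upper estimate: let [omega ^ b] be the leading power of
    [max (alpha_0, alpha)].  Inside an [l1]-[K] tree, each descent through
    [omega ^ b] derivatives provides a convex block that is hardly met by any
    set of rank less than [omega ^ b] fixed in advance.  Choosing blocks one
    after the other, and letting [F_n] matter only once [theta_n] times the
    [l1]-norm of what was chosen before is large, an average of [M] such blocks
    is small for the [F_0]-norm and for all [theta_n]-averages with [n] large.
    This uses each index [alpha_n] separately, never the index of the union of
    the [F_n].  Averaging the resulting vectors again over descents of order
    about [alpha_n0], so that sets of [F_1, ..., F_n0] rarely split them,
    contracts the norm by the factor [theta_1] up to a small error.  Finitely
    many rounds push the norm below [1 / K], which is impossible.

    The cases (2)-(4) are ordinal arithmetic. *)

(** * Ordinal arithmetic on Brouwer trees *)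

Lemma Ole_refl a : Ole a a.
Proof.
elim: a => [|a IH|f IH]; [exact: Ole_Z|exact: Ole_SS|].
by apply: Ole_Ll => n; apply: (Ole_Lr (n := n)).
Qed.
Hint Resolve Ole_refl : core.

Lemma Ole_of_leZ a b : Ole a OZ -> Ole a b.
Proof.
move E : OZ => z H; elim: H E => // [c _|f c _ IH E]; first exact: Ole_Z.
by apply: Ole_Ll => n; apply: IH.
Qed.

Lemma Ole_trans b a c : Ole a b -> Ole b c -> Ole a c.
Proof.
move=> ab bc; elim: bc a ab => {b c}.
- by move=> b a; apply: Ole_of_leZ.
- move=> b c bc IH a; move E : (OS b) => sb H.
  elim: H E => // {a sb}.
  + by move=> d _; apply: Ole_Z.
  + by move=> a d ad _ [Eb]; apply/Ole_SS/IH; rewrite Eb.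
  + by move=> a d ad _ [Eb]; apply/Ole_Sr/IH; rewrite Eb.
  + by move=> f d _ IHf Eb; apply: Ole_Ll => n; apply: IHf.
- by move=> b c bc IH a ab; apply/Ole_Sr/IH.
- move=> f c _ IH a; move E : (OL f) => sb H.
  elim: H E => // {a sb}.
  + by move=> d _; apply: Ole_Z.
  + by move=> g d _ IHg Eb; apply: Ole_Ll => n; apply: IHg.
  + by move=> a g n ag _ [Eg]; apply: (IH n); rewrite Eg.
- by move=> b f n _ IH a ab; apply: (Ole_Lr (n := n)); apply: IH.
Qed.

Lemma Ole_SS_inv a b : Ole (OS a) (OS b) -> Ole a b.
Proof.
move E1 : (OS a) => x; move E2 : (OS b) => y H.
elim: H a E1 b E2 => //.
- by move=> c d cd _ a [->] b [->].
- move=> c d cd IH a Ea b [Eb]; rewrite Eb; apply: (Ole_trans _ cd).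
  by rewrite -Ea; apply/Ole_Sr.
Qed.

Lemma Olt_OL_inv a f : Olt a (OL f) -> exists n, Olt a (f n).
Proof.
rewrite /Olt; move E1 : (OS a) => x; move E2 : (OL f) => y H.
case: H E1 E2 => //.
by move=> c g n cg Ea [->]; exists n.
Qed.

Lemma Olt_Z_inv a : ~ Olt a OZ.
Proof. by rewrite /Olt => H; inversion H. Qed.

Lemma Ole_OL f n : Ole (f n) (OL f).
Proof. exact: (Ole_Lr (n := n)). Qed.

Lemma Ole_OLOL f g : (forall n, Ole (f n) (g n)) -> Ole (OL f) (OL g).
Proof. by move=> H; apply: Ole_Ll => n; apply/(Ole_Lr (n := n))/H. Qed.

(** Totality is classical: at a limit one decides whether some member of the sequence already
    decides the comparison. *)
Lemma OleVlt a b : Ole a b \/ Olt b a.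
Proof.
elim: a b => [|a IH|g IH] b; first by left; apply: Ole_Z.
- elim: b => [|b _|f IHf].
  + by right; apply/Ole_SS/Ole_Z.
  + by case: (IH b) => H; [left; apply: Ole_SS|right; apply: Ole_SS].
  + have [[n Hn]|H] := pselect (exists n, Ole (OS a) (f n)).
      by left; apply: (Ole_Lr (n := n)).
    right; apply/Ole_SS/Ole_Ll => n; case: (IHf n) => [Hn|/Ole_SS_inv//].
    by case: H; exists n.
- have [H|/existsNP[n Hn]] := pselect (forall n, Ole (g n) b).
    by left; apply: Ole_Ll.
  by case: (IH n b) => // H; right; apply: (Ole_Lr (n := n)).
Qed.

Lemma Olt_le a b : Olt a b -> Ole a b.
Proof. by apply: Ole_trans; apply: Ole_Sr. Qed.

Lemma Olt_irr a : ~ Olt a a.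
Proof.
elim: a => [|a IH|f IH]; first exact: Olt_Z_inv.
  by move/Ole_SS_inv.
move=> /Olt_OL_inv[n H]; apply: (IH n); apply: (Ole_trans _ H).
by apply/Ole_SS/Ole_OL.
Qed.

Lemma oadd0 a : oadd OZ a = a.
Proof.
by elim: a => //= [a ->//|f IH]; congr OL; apply: funext => n; apply: IH.
Qed.

Lemma oaddA a b c : oadd a (oadd b c) = oadd (oadd a b) c.
Proof.
by elim: c => //= [c ->//|f IH]; congr OL; apply: funext => n; apply: IH.
Qed.

Lemma omulDr a b c : omul a (oadd b c) = oadd (omul a b) (omul a c).
Proof.
elim: c => //= [c ->|f IH]; first by rewrite oaddA.
by congr OL; apply: funext => n; apply: IH.
Qed.

Lemma omulA a b c : omul a (omul b c) = omul (omul a b) c.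
Proof.
elim: c => //= [c <-|f IH]; first by rewrite omulDr.
by congr OL; apply: funext => n; apply: IH.
Qed.

Lemma omul1 a : omul a (OS OZ) = a.
Proof. exact: oadd0. Qed.

Lemma oexpD a b c : oexp a (oadd b c) = omul (oexp a b) (oexp a c).
Proof.
elim: c => [|c IH|f IH]; first by rewrite omul1.
  by rewrite /= IH omulA.
by rewrite /=; congr OL; apply: funext => n; apply: IH.
Qed.

Lemma oexpM a b c : oexp a (omul b c) = oexp (oexp a b) c.
Proof.
elim: c => // [c IH|f IH]; first by rewrite /= oexpD IH.
by rewrite /=; congr OL; apply: funext => n; apply: IH.
Qed.

Lemma ofnatD m n : ofnat (m + n) = oadd (ofnat m) (ofnat n).
Proof. by elim: n => [|n IH]; rewrite ?addn0 // addnS /= IH. Qed.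

Lemma ofnatM m n : ofnat (m * n) = omul (ofnat m) (ofnat n).
Proof. by elim: n => [|n IH]; rewrite ?muln0 // mulnS addnC ofnatD IH. Qed.

Lemma ofnat_le m n : (m <= n)%N -> Ole (ofnat m) (ofnat n).
Proof.
elim: n m => [|n IH] [|m] //= H; try exact: Ole_Z.
exact/Ole_SS/IH.
Qed.

Lemma Ole_oaddr a b : Ole a (oadd a b).
Proof.
elim: b => //= [b IH|f IH]; first exact: Ole_Sr.
exact: (Ole_Lr (n := 0)).
Qed.

Lemma oadd_le2l a b c : Ole b c -> Ole (oadd a b) (oadd a c).
Proof.
elim=> [d|d e _ IH|d e _ IH|f d _ IH|d f n _ IH] /=.
- exact: Ole_oaddr.
- exact: Ole_SS.
- exact: Ole_Sr.
- exact: Ole_Ll.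
- exact: (Ole_Lr (n := n)).
Qed.

Lemma oadd_le2r a b c : Ole a b -> Ole (oadd a c) (oadd b c).
Proof.
move=> ab; elim: c => //= [c IH|f IH]; first exact: Ole_SS.
exact: Ole_OLOL.
Qed.

Lemma omul_le2l a b c : Ole b c -> Ole (omul a b) (omul a c).
Proof.
elim=> [d|d e _ IH|d e _ IH|f d _ IH|d f n _ IH] /=.
- exact: Ole_Z.
- exact: oadd_le2r.
- by apply: (Ole_trans IH); apply: Ole_oaddr.
- exact: Ole_Ll.
- exact: (Ole_Lr (n := n)).
Qed.

Lemma omul_le2r a b c : Ole a b -> Ole (omul a c) (omul b c).
Proof.
move=> ab; elim: c => //= [c IH|f IH]; last exact: Ole_OLOL.
exact: (Ole_trans (oadd_le2r _ IH) (oadd_le2l _ ab)).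
Qed.

Lemma omul_le a b c d : Ole a b -> Ole c d -> Ole (omul a c) (omul b d).
Proof. by move=> ab cd; apply: (Ole_trans (omul_le2r _ ab)); apply: omul_le2l. Qed.

Lemma Ole_omulr a b : Ole (OS OZ) b -> Ole a (omul a b).
Proof. by move=> /(omul_le2l a); rewrite omul1. Qed.

Lemma omul1l a : omul (OS OZ) a = a.
Proof.
by elim: a => //= [a ->//|f IH]; congr OL; apply: funext => n; apply: IH.
Qed.

Lemma Ole_omull a b : Ole (OS OZ) b -> Ole a (omul b a).
Proof. by move=> /(omul_le2r a); rewrite omul1l. Qed.

Lemma oexp_ge1 a b : Ole (OS OZ) a -> Ole (OS OZ) (oexp a b).
Proof.
move=> a1; elim: b => //= [b IH|f IH].
  by apply: (Ole_trans a1); apply: Ole_omull.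
exact: (Ole_Lr (n := 0)).
Qed.

Lemma oexp_le2l a b c : Ole (OS OZ) a -> Ole b c -> Ole (oexp a b) (oexp a c).
Proof.
move=> a1; elim=> [d|d e _ IH|d e _ IH|f d _ IH|d f n _ IH] /=.
- exact: oexp_ge1.
- exact: omul_le2r.
- by apply: (Ole_trans IH); apply: Ole_omulr.
- exact: Ole_Ll.
- exact: (Ole_Lr (n := n)).
Qed.

Lemma oexp_le2r a b c : Ole a b -> Ole (oexp a c) (oexp b c).
Proof.
move=> ab; elim: c => //= [c IH|f IH]; first exact: omul_le.
exact: Ole_OLOL.
Qed.

Lemma oexp_ofnatS a k : omul a (oexp a (ofnat k)) = oexp a (ofnat k.+1).
Proof.
elim: k => [|k IH]; first by rewrite omul1 [RHS]omul1l.
by rewrite [in LHS]/= omulA IH.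
Qed.

(** The extra factor is absorbed because [1 + omega = omega] in the exponent. This brings the upper
    bound of cases (3) and (4) down to [oexp a omega]. *)
Lemma omul_oexp_omega a : Ole (omul a (oexp a omega)) (oexp a omega).
Proof.
apply: Ole_Ll => k; rewrite -/(omul a (oexp a (ofnat k))) oexp_ofnatS.
exact: (Ole_Lr (n := k.+1)).
Qed.

Lemma omega_ge1 : Ole (OS OZ) omega.
Proof. exact: (Ole_Lr (n := 1)). Qed.
Hint Resolve omega_ge1 : core.

(** Since [m < 2 ^ m], the number of blocks in an average is absorbed by a finite power of the index
    of a family. *)
Lemma ofnat_le_expn m a : Ole (ofnat 2) a -> exists k, Ole (ofnat m) (oexp a (ofnat k)).
Proof.
move=> a2; exists m.
apply: (@Ole_trans (oexp (ofnat 2) (ofnat m))); last exact: oexp_le2r.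
have -> : oexp (ofnat 2) (ofnat m) = ofnat (2 ^ m).
  by elim: m => //= m ->; rewrite expnSr ofnatM.
by apply/ofnat_le/ltnW/ltn_expl.
Qed.

(* A coarse Cantor normal form: [b] is the leading exponent of [g]. *)
Lemma omega_power_bracket g : Ole (OS OZ) g ->
  exists b c, Ole (oexp omega b) g /\ Ole g (omul (oexp omega b) (ofnat c)).
Proof.
elim: g => [/Olt_Z_inv//|g IH _|f IH f1].
  have [g1|g1] := OleVlt (OS OZ) g.
    have [b [c [H1 H2]]] := IH g1; exists b, c.+1; split; first exact: Ole_Sr.
    apply: (@Ole_trans (oadd g (OS OZ))); first by [].
    apply: (Ole_trans (oadd_le2r _ H2)); apply: oadd_le2l; exact: oexp_ge1.
  exists OZ, 1; split; first by apply/Ole_SS/Ole_Z.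
  exact: g1.
have f1' : exists n, Ole (OS OZ) (f n) by apply: Olt_OL_inv.
have {}IH n : exists b, (Ole (OS OZ) (f n) -> Ole (oexp omega b) (f n)) /\
    Ole (f n) (oexp omega (OS b)).
  have [fn|fn] := OleVlt (OS OZ) (f n).
    have [b [c [H1 H2]]] := IH n fn; exists b; split=> //.
    by apply: (Ole_trans H2); apply: (Ole_Lr (n := c)).
  exists OZ; split=> [H|].
    by case: (@Olt_irr (OS OZ)); apply: (Ole_trans _ fn); apply: Ole_SS.
  by move/Ole_SS_inv: fn => fn; apply: (Ole_trans fn); apply: Ole_Z.
have [bb Hb] := choice IH.
have [n0 Hn0] := f1'.
(* The leading exponents of the members are joined into one supremum. A member below 1 has none, and
   borrows that of [f n0], which is at least 1. *)
pose b := OL (fun n => if `[< Ole (OS OZ) (f n) >] then bb n else bb n0).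
have bf : Ole (oexp omega b) (OL f).
  apply: Ole_Ll => n; case: asboolP => [fn|_].
    by apply: (Ole_Lr (n := n)); case: (Hb n) => H _; apply: H.
  by apply: (Ole_Lr (n := n0)); case: (Hb n0) => H _; apply: H.
have fb : Ole (OL f) (oexp omega (OS b)).
  apply: Ole_Ll => n.
  have [fn|fn] := pselect (Ole (OS OZ) (f n)).
    case: (Hb n) => _ /Ole_trans; apply; apply: oexp_le2l => //; apply: Ole_SS.
    by apply: (Ole_Lr (n := n)); rewrite asboolT.
  case: (OleVlt (OS OZ) (f n)) => // /Ole_SS_inv H.
  by apply: (Ole_trans H); apply: Ole_Z.
(* If no finite multiple of [oexp omega b] bounds the limit, totality puts the limit above all of
   them, hence above the next power of [omega], and [fb] gives the other inequality. *)
have [[c Hc]|H] := pselect (exists c, Ole (OL f) (omul (oexp omega b) (ofnat c))).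
  by exists b, c.
exists (OS b), 1; split; last by rewrite omul1.
apply: Ole_Ll => c; case: (OleVlt (OL f) (omul (oexp omega b) (ofnat c))).
  by move=> Hc; case: H; exists c.
exact: Olt_le.
Qed.

(** * Derivatives of trees and of families of finite sets *)

Section TreeDerivative.
Variable X : Type.
Implicit Types (T U : seq X -> Prop) (s t : seq X).

(** Only extensions by one entry are asked for; [treeD_iterE] shows that on prefix-closed sets this
    agrees with [treeD]. *)
Definition tder T s : Prop := T s /\ exists x, T (rcons s x).

Fixpoint tder_iter (b : Ord) T : seq X -> Prop :=
  match b with
  | OZ => T
  | OS b' => tder (tder_iter b' T)
  | OL f => fun s => forall n, tder_iter (f n) T s
  end.

Definition prefix_closed T := forall s i, T s -> T (take i s).

Lemma tder_mono T U : (forall s, T s -> U s) -> forall s, tder T s -> tder U s.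
Proof. by move=> H s [Ts [x Tx]]; split; [apply: H|exists x; apply: H]. Qed.

Lemma tder_iter_sub b T s : tder_iter b T s -> T s.
Proof.
by elim: b s => //= [b IH s [/IH//]|f IH s /(_ 0)/IH].
Qed.

Lemma tder_iter_mono b T U :
  (forall s, T s -> U s) -> forall s, tder_iter b T s -> tder_iter b U s.
Proof.
move=> H; elim: b => //= [b IH|f IH s Hs n]; first exact: tder_mono.
exact/IH/Hs.
Qed.

Lemma tder_iter_anti a b T : Ole a b ->
  forall s, tder_iter b T s -> tder_iter a T s.
Proof.
elim=> {a b} [b|a b _ IH|a b _ IH|f b _ IH|a f n _ IH] s /=.
- exact: tder_iter_sub.
- exact: tder_mono.
- by case=> /IH.
- by move=> H n; apply: IH.
- by move=> /(_ n)/IH.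
Qed.

Lemma tder_iter_add a b T s :
  tder_iter (oadd a b) T s <-> tder_iter b (tder_iter a T) s.
Proof.
elim: b s => //= [b IH|f IH] s.
  by split; apply: tder_mono => t /IH.
by split=> H n; apply/IH.
Qed.

(** A derivative at a node looks only at extensions of that node, so ranks may be computed in the
    section of [T] at [s]. *)
Lemma tder_iter_at b T s t :
  tder_iter b (fun u => T (s ++ u)) t <-> tder_iter b T (s ++ t).
Proof.
elim: b t => //= [b IH|f IH] t; last by split=> H n; apply/IH.
split=> -[/IH H1 [x H2]]; split=> //; exists x; last by apply/IH; rewrite -rcons_cat.
by move/IH: H2; rewrite -rcons_cat.
Qed.

Lemma prefix_closed_tder T : prefix_closed T -> prefix_closed (tder T).
Proof.
move=> cT s i [Ts [x Tx]]; split; first exact: cT.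
case: (leqP (size s) i) => [si|si]; first by exists x; rewrite take_oversize.
exists (nth x s i); rewrite -take_nth //; exact: cT.
Qed.

Lemma prefix_closed_tder_iter b T :
  prefix_closed T -> prefix_closed (tder_iter b T).
Proof.
move=> cT; elim: b => //= [b IH|f IH s i H n]; first exact: prefix_closed_tder.
exact/IH/H.
Qed.

End TreeDerivative.

Lemma treeD_iterE (R : realType) (T : seq (vec R) -> Prop) b :
  prefix_closed T -> forall s, treeD_iter b T s <-> tder_iter b T s.
Proof.
move=> cT; elim: b => //= [b IH|f IH] s; last by split=> H n; apply/IH.
have cb := @prefix_closed_tder_iter _ b T cT.
split=> -[/IH Ts].
  move=> [t [/IH Tt [lt_st st]]]; split=> //; exists (nth (zv R) t (size s)).
  have -> : rcons s (nth (zv R) t (size s)) = take (size s).+1 t by rewrite (take_nth (zv R)) ?st.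
  exact: cb.
move=> [x Tx]; split=> //.
by exists (rcons s x); rewrite size_rcons -cats1 take_size_cat // cats1; split; [exact/IH|].
Qed.

(** * Families of finite sets as trees of increasing enumerations *)

Definition subseq_closed (G : seq nat -> Prop) :=
  forall s t, G t -> subseq s t -> G s.

Definition sorted_family (G : seq nat -> Prop) :=
  (forall s, G s -> sorted ltn s) /\ subseq_closed G.

Lemma sorted_family_tder_iter b G :
  sorted_family G -> sorted_family (tder_iter b G).
Proof.
move=> [oG cG]; split; first by move=> s /tder_iter_sub/oG.
elim: b => //= [b IH|f IH]; last by move=> s t H st n; apply: IH (H n) st.
move=> s t [Gt [k Gk]] st; split; first exact: IH Gt st.
exists k; apply: IH Gk _.
by rewrite -!cats1; apply: cat_subseq.
Qed.

Lemma sorted_family_at G s :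
  sorted_family G -> sorted_family (fun u => G (s ++ u)).
Proof.
move=> [oG cG]; split; first by move=> u /oG /cat_sorted2[].
by move=> u v Gv uv; apply: cG Gv _; apply: cat_subseq.
Qed.

Definition family_tree (G : fam) (s : seq nat) : Prop :=
  sorted ltn s /\ G (fun k => k \in s).

Lemma sorted_family_tree G : hereditary G -> sorted_family (family_tree G).
Proof.
move=> hG; split=> [s []//|s t [so Gt] st]; split.
  exact: subseq_sorted ltn_trans _ _ st so.
by apply: hG Gt _ => k; apply: mem_subseq.
Qed.

Definition spread_closed (G : seq nat -> Prop) :=
  forall s t, G s -> sorted ltn t -> size s = size t ->
    (forall i, (i < size s)%N -> (nth 0 s i <= nth 0 t i)%N) -> G t.

Lemma spread_closed_family_tree G : spreading G -> spread_closed (family_tree G).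
Proof. by move=> sG s t [so Gs] to st H; split=> //; apply: (sG _ _ s t). Qed.

Lemma sorted_rcons_ltn (s : seq nat) k :
  sorted ltn (rcons s k) = sorted ltn s && all (fun j => (j < k)%N) s.
Proof.
rewrite -rev_sorted rev_rcons /= path_sortedE; last by move=> a b c /=; lia.
by rewrite rev_sorted all_rev andbC.
Qed.

Lemma spread_rcons G s k l : spread_closed G -> G (rcons s k) ->
  sorted ltn (rcons s l) -> (k <= l)%N -> G (rcons s l).
Proof.
move=> sG Gk sl kl; apply: sG Gk sl _ _; first by rewrite !size_rcons.
move=> i _; rewrite !nth_rcons; case: ifP => // _; case: ifP => //.
Qed.

Lemma spread_closed_tder_iter b G : (forall s, G s -> sorted ltn s) ->
  spread_closed G -> spread_closed (tder_iter b G).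
Proof.
move=> oG sG; elim: b => //= [b IH|f IH]; last first.
  by move=> s t H st sz le n; apply: IH (H n) st sz le.
move=> s t [Gs [k Gk]] so sz le; split; first exact: IH Gs so sz le.
(* [l] is at least [k] and exceeds every member of [t], so [rcons t l] is an increasing spread of
   [rcons s k]. *)
pose l := (k + \sum_(j <- t) j.+1)%N.
exists l; apply: IH Gk _ _ _; last 2 first.
- by rewrite !size_rcons sz.
- move=> i; rewrite size_rcons ltnS !nth_rcons -sz => ik.
  case: ltnP => [/le//|H]; case: ifP => // _; exact: leq_addr.
rewrite sorted_rcons_ltn so; apply/allP => j jt.
by rewrite /l (big_rem j jt) /=; lia.
Qed.

Lemma sorted_subset_subseq (s t : seq nat) : sorted ltn s -> sorted ltn t ->
  {subset s <= t} -> subseq s t.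
Proof.
move=> so to st; have -> : s = [seq k <- t | k \in s].
  apply: (irr_sorted_eq ltn_trans ltnn) => //; first exact: sorted_filter ltn_trans _ _ to.
  by move=> k; rewrite mem_filter; case: (boolP (k \in s)) => //= /st->.
exact: filter_subseq.
Qed.

(* For hereditary spreading families the Cantor-Bendixson derivative and the
   derivative of the tree of increasing enumerations coincide. *)
Lemma tder_iter_cb G b s : regular G ->
  tder_iter b (family_tree G) s -> cb_iter b G (fun k => k \in s).
Proof.
move=> [_ hG sG _]; elim: b s => /= [|b IH|f IH] s; first by case.
  have oG t : family_tree G t -> sorted ltn t by case.
  have sb := spread_closed_tder_iter (b := b) oG (spread_closed_family_tree sG).
  move=> [/IH Gs [k Gk]]; split=> // m.
  pose l := (maxn k m + \sum_(j <- s) j.+1)%N.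
  have ls j : j \in s -> (j < l)%N.
    by move=> js; rewrite /l (big_rem j js) /=; lia.
  exists (fun j => j \in rcons s l); split; [|split].
  - apply: IH; apply: (spread_rcons sb Gk); last by rewrite /l; lia.
    rewrite sorted_rcons_ltn; apply/andP; split; last by apply/allP.
    by move/tder_iter_sub: Gk => [+ _]; rewrite sorted_rcons_ltn => /andP[].
  - exists l; rewrite mem_rcons inE eqxx /=; apply/negP => /eqP E.
    by have := ls l; rewrite -E ltnn => /(_ isT).
  - move=> j jm; rewrite mem_rcons inE; case: eqP => // jl.
    by move: jm; rewrite jl /l; lia.
by move=> H n; apply: IH.
Qed.

(** A member [B] of the family that agrees with [s] far enough and differs from it contains a
    further element [k] beyond [s]; heredity cuts [B] down to [rcons s k]. *)
Lemma cb_tder_iter G b A s : regular G -> sorted ltn s -> (forall k, A k = (k \in s)) ->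
  cb_iter b G A -> tder_iter b (family_tree G) s.
Proof.
move=> [fG hG sG _].
have := sorted_family_tree hG => fam.
elim: b s A => /= [|b IH|f IH] s A so sA.
- move=> GA; split=> //; apply: hG GA _ => k; by rewrite sA.
- move=> [/IH Gs H]; split; first exact: Gs.
  pose m := (\sum_(j <- s) j.+1)%N.
  have ls j : j \in s -> (j < m)%N.
    by move=> js; rewrite /m (big_rem j js) /=; lia.
  have [B [GB [[k Bk] Bs]]] := H m.
  have km : (m <= k)%N by rewrite leqNgt; apply/negP => /Bs E; rewrite E eqxx in Bk.
  have Ak : A k = false by rewrite sA; apply/negP => /ls; lia.
  have {}Bk : B k by move: Bk; rewrite Ak; case: (B k).
  have fB : finset_nat B.
    apply: fG; elim: b {IH Gs H} GB => //= [b IH [/IH//]|f IH /(_ 0)/IH//].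
  have [p Hp] := fB.
  exists k; pose t := [seq j <- iota 0 p | B j].
  have ot : sorted ltn t by apply: sorted_filter; [exact: ltn_trans|exact: iota_ltn_sorted].
  have tB j : B j = (j \in t).
    rewrite mem_filter mem_iota /= add0n.
    by case: (leqP p j) => [/Hp->|_]; rewrite ?andbT.
  have [_ cl] := sorted_family_tder_iter b fam.
  apply: (cl _ t); first exact: IH tB GB.
  apply: sorted_subset_subseq => //.
    by rewrite sorted_rcons_ltn so; apply/allP => j /ls; lia.
  by move=> j; rewrite mem_rcons inE => /orP[/eqP->|js]; rewrite -tB // Bs ?sA // ls.
- by move=> H n; apply: IH (H n).
Qed.

(** * Averages along trees that are hit rarely by sets of small rank *)

Lemma sorted_split_at N (A : seq nat) : sorted ltn A ->
  A = [seq k <- A | (k < N)%N] ++ [seq k <- A | (N <= k)%N].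
Proof.
elim: A => //= a A IH pA; have {}IH := IH (path_sorted pA).
case: ltnP => aN /=; first by rewrite -IH.
have /allP aA := order_path_min ltn_trans pA.
suff -> : [seq k <- A | (k < N)%N] = [::].
  by rewrite /=; congr cons; apply/esym/all_filterP/allP => k /aA /=; lia.
by apply/eqP; rewrite -[_ == _]negbK -has_filter; apply/hasPn => k /aA /=; lia.
Qed.

(** Used to keep a list of families finite when each family is replaced by its sections at all
    possible initial parts below [N]. *)
Lemma sorted_bounded_enum N : exists Bs : list (seq nat),
  forall B, sorted ltn B -> (forall k, k \in B -> (k < N)%N) -> List.In B Bs.
Proof.
elim: N => [|N [Bs IH]].
  by exists [:: [::]] => -[|a B] _ H; [left|have := H a (mem_head _ _)].
exists (List.app Bs (List.map (rcons^~ N) Bs)) => B; case/lastP: B => [|B a].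
  by move=> _ _; apply/List.in_app_iff; left; apply: IH.
rewrite sorted_rcons_ltn => /andP[so /allP lB] H.
apply/List.in_app_iff; have := H a; rewrite mem_rcons mem_head => /(_ isT).
rewrite ltnS leq_eqVlt => /orP[/eqP aN|aN].
  right; apply/List.in_map_iff; exists B; split; first by rewrite aN.
  by apply: IH => // k /lB; rewrite aN.
left; apply: IH; first by rewrite sorted_rcons_ltn so; apply/allP.
by move=> k; rewrite mem_rcons inE => /orP[/eqP->//|/lB]; lia.
Qed.

Lemma large_multiple (R : realType) (c e : R) :
  0 <= c -> 0 < e -> exists2 m, (0 < m)%N & c <= m%:R * e.
Proof.
move=> c0 e0; exists (Num.bound (c / e)).+1 => //.
rewrite -ler_pdivrMr //; apply/ltW/(lt_le_trans (archi_boundP _)).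
  by rewrite divr_ge0 // ltW.
by rewrite ler_nat.
Qed.

(** Of two bounds, totality selects the larger one; [h] is not assumed monotone. *)
Lemma uniform_rank_bound (h : nat -> Ord) (Gs : list (seq nat -> Prop)) :
  (forall G, List.In G Gs -> exists n, ~ tder_iter (h n) G [::]) ->
  exists n, forall G, List.In G Gs -> ~ tder_iter (h n) G [::].
Proof.
elim: Gs => [|G Gs IH] H; first by exists 0%N.
have [n1 H1] := H G (or_introl erefl).
have [n2 H2] := IH (fun G' i => H G' (or_intror i)).
have [le|/Olt_le le] := OleVlt (h n1) (h n2).
  exists n2 => G' [<-|/H2//] /(tder_iter_anti le); exact: H1.
exists n1 => G' [<-//|/H2 HG] /(tder_iter_anti le); exact: HG.
Qed.

(** With [c] least such that the derivative of order [d * c] no longer contains the empty set, the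
    derivative one multiple of [d] earlier is the top layer. It has rank below [d], so a small
    average can be chosen against it. *)
Lemma top_layers (d : Ord) (Gs : list (seq nat -> Prop)) :
  (forall G, List.In G Gs -> sorted_family G) ->
  exists Gs' : list (seq nat -> Prop),
    (forall G, List.In G Gs' -> sorted_family G /\ ~ tder_iter d G [::]) /\
    forall G c, List.In G Gs -> G [::] -> ~ tder_iter (omul d (ofnat c)) G [::] ->
      exists c', (c' < c)%N /\ List.In (tder_iter (omul d (ofnat c')) G) Gs'.
Proof.
elim: Gs => [|G Gs IH] H; first by exists [::].
have [Gs' [H1 H2]] := IH (fun G' i => H G' (or_intror i)).
have fG := H G (or_introl erefl).
have [[G0 exc]|nexc] :=
  pselect (G [::] /\ exists c, `[< ~ tder_iter (omul d (ofnat c)) G [::] >]); last first.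
  exists Gs'; split=> // G' c [<-|GG]; last exact: H2.
  by move=> G0 Hc; case: nexc; split=> //; exists c; apply/asboolP.
case: (ex_minnP exc) => -[|c'] /asboolP Hc minc; first by [].
exists (tder_iter (omul d (ofnat c')) G :: Gs'); split.
  move=> _ [<-|/H1//]; split; first exact: sorted_family_tder_iter.
  by move/tder_iter_add.
move=> G' c [<-|GG] G0' Hc0; last first.
  by have [c0 [lt inG]] := H2 G' c GG G0' Hc0; exists c0; split=> //; right.
exists c'; split; last by left.
by apply: minc; apply/asboolP.
Qed.

(** * Weighted walks through states with a rank *)

Section Averaging.
Variables (R : realType) (S X : Type) (top : S -> nat).
Variables (step : S -> X -> S -> Prop) (Rk : Ord -> S -> Prop).
Hypothesis step_top : forall s x s', step s x s' -> (top s <= top s')%N.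
Hypothesis Rk_anti : forall a b s, Ole a b -> Rk b s -> Rk a s.
Hypothesis Rk_succ : forall a s, Rk (OS a) s -> exists x s', step s x s' /\ Rk a s'.

Notation wstep := (R * (S * X * S))%type.

(** Walks are abstract because they are used with two kinds of steps: adding one vector to a node in
    [attains_base], and producing a whole [good] vector in [attains_improve]. *)
Fixpoint walk (s : S) (l : seq wstep) (s' : S) : Prop :=
  match l with
  | [::] => s = s'
  | p :: l' => [/\ p.2.1.1 = s, 0 <= p.1, step s p.2.1.2 p.2.2 & walk p.2.2 l' s']
  end.

Definition mass (l : seq wstep) : R := \sum_(p <- l) p.1.

(** The interval between the two tops is where the vector of the step will be supported. *)
Definition hit (A : seq nat) (p : S * X * S) : bool :=
  has (fun k => (top p.1.1 <= k < top p.2)%N) A.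

Definition hitmass (A : seq nat) (l : seq wstep) : R :=
  \sum_(p <- l) p.1 * (hit A p.2)%:R.

(** Each block carries its starting state, because that state decides which families are active for
    the block. *)
Fixpoint multiwalk (s : S) (L : seq (S * seq wstep)) (s' : S) : Prop :=
  match L with
  | [::] => s = s'
  | q :: L' => [/\ q.1 = s, mass q.2 = 1 &
      exists s1, walk s q.2 s1 /\ multiwalk s1 L' s']
  end.

Definition rescale (a : R) (l : seq wstep) : seq wstep :=
  [seq (a * p.1, p.2) | p <- l].

Lemma walk_top s l s' : walk s l s' -> (top s <= top s')%N.
Proof.
elim: l s => [|p l IH] s /=; first by move->.
by case=> _ _ /step_top H /IH; apply: leq_trans.
Qed.

Lemma walk_cat s1 l1 s2 l2 s3 :
  walk s1 l1 s2 -> walk s2 l2 s3 -> walk s1 (l1 ++ l2) s3.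
Proof.
elim: l1 s1 => [|p l IH] s1 /=; first by move->.
by case=> ? ? ? H1 H2; split=> //; apply: IH.
Qed.

Lemma walk_rescale a s l s' : 0 <= a -> walk s l s' -> walk s (rescale a l) s'.
Proof.
move=> a0; elim: l s => [|p l IH] s //= [? ? ? /IH H]; split=> //.
exact: mulr_ge0.
Qed.

Lemma walk_In s l s' p : walk s l s' -> List.In p l ->
  0 <= p.1 /\ step p.2.1.1 p.2.1.2 p.2.2.
Proof.
elim: l s => [|p' l IH] s //= [ps p0 st wl] [<-|]; last exact: IH wl.
by rewrite ps.
Qed.

Lemma hitmass_ge0 A s l s' : walk s l s' -> 0 <= hitmass A l.
Proof.
rewrite /hitmass; elim: l s => [|p l IH] s /=; first by rewrite big_nil.
case=> _ p0 _ /IH H; rewrite big_cons addr_ge0 // mulr_ge0 //.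
Qed.

Lemma hitmass_le_mass A s l s' : walk s l s' -> hitmass A l <= mass l.
Proof.
rewrite /hitmass /mass; elim: l s => [|p l IH] s /=; first by rewrite !big_nil.
case=> _ p0 _ /IH H; rewrite !big_cons lerD // ler_piMr //.
by case: (hit _ _); rewrite ?ler01 ?lexx.
Qed.

Lemma eq_hitmass A B s l s' : walk s l s' ->
  (forall k, (top s <= k < top s')%N -> (k \in A) = (k \in B)) ->
  hitmass A l = hitmass B l.
Proof.
rewrite /hitmass; elim: l s => [|p l IH] s /=; first by rewrite !big_nil.
case=> ps _ /step_top lt wl AB; rewrite !big_cons (IH _ wl); last first.
  by move=> k kp; apply: AB; lia.
have lt' := walk_top wl.
congr (_ * _%:R + _); congr nat_of_bool.
have E k : (top s <= k < top p.2.2)%N -> (k \in A) = (k \in B).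
  by move=> kp; apply: AB; lia.
rewrite /hit ps.
by apply/hasP/hasP => -[k kA kp]; exists k => //; move: kA; rewrite E.
Qed.

Lemma eq_multiwalk_hitmass A B s L s' (P : pred (S * seq wstep)) :
  multiwalk s L s' ->
  (forall k, (top s <= k)%N -> (k \in A) = (k \in B)) ->
  \sum_(q <- L | P q) hitmass A q.2 = \sum_(q <- L | P q) hitmass B q.2.
Proof.
elim: L s => [|q L IH] s /=; first by rewrite !big_nil.
case=> _ _ [s1 [w1 mw]] AB; have lt := walk_top w1.
rewrite !big_cons (IH _ mw); last by move=> k ks; apply: AB; lia.
rewrite (eq_hitmass w1 (B := B)) // => k ks; apply: AB; lia.
Qed.

Lemma multiwalk_hitmass_subsum A s L s' (P : pred (S * seq wstep)) :
  multiwalk s L s' ->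
  \sum_(q <- L | P q) hitmass A q.2 <= \sum_(q <- L) hitmass A q.2.
Proof.
elim: L s => [|q L IH] s /=; first by rewrite !big_nil.
case=> _ _ [s1 [/hitmass_ge0 h0 /IH H]]; rewrite !big_cons.
by case: (P q); rewrite ?lerD2l // ler_wpDl.
Qed.

Definition flatten_walk (a : R) (L : seq (S * seq wstep)) : seq wstep :=
  flatten [seq rescale a q.2 | q <- L].

Lemma walk_flatten a s L s' : 0 <= a -> multiwalk s L s' ->
  walk s (flatten_walk a L) s'.
Proof.
move=> a0; elim: L s => [|q L IH] s //= [_ _ [s1 [w1 /IH H]]].
by apply: walk_cat H; apply: walk_rescale.
Qed.

Lemma sum_flatten (g : S * X * S -> R) a L :
  \sum_(p <- flatten_walk a L) p.1 * g p.2 =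
  a * \sum_(q <- L) \sum_(p <- q.2) p.1 * g p.2.
Proof.
rewrite /flatten_walk; elim: L => [|q L IH] /=; first by rewrite !big_nil mulr0.
rewrite big_cat /= IH big_cons mulrDr; congr (_ + _).
by rewrite big_map mulr_sumr; apply: eq_bigr => p _; rewrite mulrA.
Qed.

Lemma hitmass_flatten A a L :
  hitmass A (flatten_walk a L) = a * \sum_(q <- L) hitmass A q.2.
Proof. exact: (sum_flatten (fun p => (hit A p)%:R)). Qed.

Lemma mass_flatten a s L s' : multiwalk s L s' ->
  mass (flatten_walk a L) = a * (size L)%:R.
Proof.
rewrite /flatten_walk /mass; elim: L s => [|q L IH] s /=; first by rewrite big_nil mulr0.
case=> _ m1 [s1 [_ /IH H]]; rewrite big_cat /= H big_map -mulr_sumr /=.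
by rewrite [X in a * X]m1 -mulrDr -natr1 addrC.
Qed.

(** A repeated average, costing [oexp omega b] derivatives. It serves only finitely many families,
    given before the block is chosen; [few_blocks_hit] is arranged around this restriction. *)
Definition small_average (b : Ord) : Prop :=
  forall (Gs : list (seq nat -> Prop)) (e : R) eta s, 0 < e ->
    (forall G, List.In G Gs ->
       sorted_family G /\ ~ tder_iter (oexp omega b) G [::]) ->
    Rk (oadd eta (oexp omega b)) s ->
    exists l s', [/\ walk s l s', mass l = 1, Rk eta s' &
      forall G A, List.In G Gs -> G A -> hitmass A l <= e].

(* A set [A] of rank less than [omega^b * c] can be charged with a full block
   at most [c] times, since each such block lowers the multiple of [omega^b]
   bounding the rank of the remaining part of [A].  The families [F n] come
   into play only from the first block at whose start they are active. *)
Lemma few_blocks_hit b (F : nat -> seq nat -> Prop) (act : nat -> S -> bool) :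
  small_average b -> (forall n, sorted_family (F n)) ->
  (forall s, exists v, forall n, act n s -> (n < v)%N) ->
  forall m (Gs : list (seq nat -> Prop)) (e : R) eta s, 0 < e ->
    (forall G, List.In G Gs -> sorted_family G) ->
    Rk (oadd eta (omul (oexp omega b) (ofnat m))) s ->
    exists L s', [/\ multiwalk s L s', size L = m, Rk eta s',
      forall G A c, List.In G Gs -> G A ->
        ~ tder_iter (omul (oexp omega b) (ofnat c)) G [::] ->
        \sum_(q <- L) hitmass A q.2 <= c%:R + m%:R * e &
      forall n A c, F n A -> ~ tder_iter (omul (oexp omega b) (ofnat c)) (F n) [::] ->
        \sum_(q <- L | act n q.1) hitmass A q.2 <= c%:R + m%:R * e].
Proof.
move=> small_b fF fact; elim=> [|m IH] Gs e eta s e0 fGs.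
  move=> Rs; exists [::], s; split=> // [G A c _ _ _|n A c _ _].
    by rewrite big_nil mul0r addr0.
  by rewrite big_nil mul0r addr0.
rewrite [omul _ _]/= oaddA => Rs.
(* Only the indices below [v] can be active at [s], so finitely many of the [F n] join the list for
   the first block. *)
have [v Hv] := fact s.
pose Gs1 := List.app Gs (List.map F (List.seq 0 v)).
have fGs1 G : List.In G Gs1 -> sorted_family G.
  by move=> /List.in_app_iff[/fGs//|/List.in_map_iff[n [<- _]]].
have [Gs2 [fGs2 HGs2]] := top_layers (oexp omega b) fGs1.
have [l [s1 [wl ml Rs1 hl]]] := small_b Gs2 e _ s e0 fGs2 Rs.
(* The later blocks lie beyond [top s1]. For them a set counts through its section at its part [B]
   below [top s1], and there are finitely many such [B]. *)
have [Bs HBs] := sorted_bounded_enum (top s1).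
pose Gs3 := List.flat_map (fun G => List.map (fun B u => G (B ++ u)) Bs) Gs1.
have fGs3 G : List.In G Gs3 -> sorted_family G.
  move=> /List.in_flat_map[G' [/fGs1 fG' /List.in_map_iff[B [<- _]]]].
  exact: sorted_family_at.
have [L [s' [mL sL Rs' H1 H2]]] := IH Gs3 e eta s1 e0 fGs3 Rs1.
have key G A c : List.In G Gs1 -> G A ->
    ~ tder_iter (omul (oexp omega b) (ofnat c)) G [::] ->
    hitmass A l + \sum_(q <- L) hitmass A q.2 <= c%:R + m.+1%:R * e.
  move=> inG GA Hc; have fG := fGs1 _ inG.
  have G0 : G [::] by case: fG => _ cG; apply: cG GA (sub0seq _).
  have [c' [lt_c inc']] := HGs2 _ _ inG G0 Hc.
  pose B := [seq k <- A | (k < top s1)%N]; pose A' := [seq k <- A | (top s1 <= k)%N].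
  have oA : sorted ltn A by case: fG => oG _; apply: oG.
  have EA : A = B ++ A' := sorted_split_at (top s1) oA.
  have inB : List.In (fun u => G (B ++ u)) Gs3.
    apply/List.in_flat_map; exists G; split=> //; apply/List.in_map_iff.
    exists B; split=> //; apply: HBs; first exact: sorted_filter ltn_trans _ _ oA.
    by move=> k; rewrite mem_filter => /andP[].
  have GA' : G (B ++ A') by rewrite -EA.
  have EL : \sum_(q <- L) hitmass A q.2 = \sum_(q <- L) hitmass A' q.2.
    by apply: (eq_multiwalk_hitmass _ mL) => k ks; rewrite mem_filter ks.
  rewrite EL -natr1 mulrDl mul1r.
  have fam_c x := sorted_family_tder_iter (omul (oexp omega b) (ofnat x)) fG.
  (* If [B] survives in the top layer, the first block is hit by mass at most [e]. If not, the
     section at [B] has rank bounded by [c'] multiples with [c' < c], and the multiple gained pays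
     for the whole first block. *)
  have [HB|HB] := pselect (tder_iter (omul (oexp omega b) (ofnat c')) G B).
    have hA : hitmass A l <= e.
      rewrite (eq_hitmass wl (B := B)); last first.
        by move=> k /andP[_ ks]; rewrite mem_filter ks.
      exact: hl inc' HB.
    suff : \sum_(q <- L) hitmass A' q.2 <= c%:R + m%:R * e by lra.
    apply: H1 inB GA' _ => /tder_iter_at; rewrite cats0 => HcB; apply: Hc.
    by case: (fam_c c) => _ cl; apply: cl HcB (sub0seq _).
  have hA : hitmass A l <= 1 by rewrite -ml; apply: hitmass_le_mass wl.
  have hL : \sum_(q <- L) hitmass A' q.2 <= c'%:R + m%:R * e.
    apply: H1 inB GA' _ => /tder_iter_at; rewrite cats0; exact: HB.
  have cc : c'%:R + 1 <= c%:R :> R by rewrite natr1 ler_nat.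
  lra.
exists ((s, l) :: L), s'; split=> //=.
- by split=> //; exists s1.
- by rewrite sL.
- move=> G A c inG; rewrite big_cons; apply: key.
  by apply/List.in_app_iff; left.
- move=> n A c FA Hc; rewrite big_cons /=; case: ifP => [an|_].
    apply: (@le_trans _ _ (hitmass A l + \sum_(q <- L) hitmass A q.2)).
      by rewrite lerD2l; apply: multiwalk_hitmass_subsum mL.
    apply: key FA Hc; apply/List.in_app_iff; right; apply/List.in_map_iff.
    by exists n; split=> //; apply/List.in_seq; have := Hv _ an; lia.
  (* A family inactive at [s] is not charged for the first block. *)
  apply: (le_trans (H2 n A c FA Hc)); rewrite lerD2l.
  by apply: ler_wpM2r; [exact: ltW|rewrite ler_nat].
Qed.

(** Induction on [b]. At zero the families contain no nonempty set, so one step will do. At a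
    successor the average of [m] blocks is taken, with [m] large against the number [c] of blocks
    that a set can hit fully. At a limit the finitely many ranks lie below a single
    [oexp omega (f n)]. *)
Lemma small_averages b : small_average b.
Proof.
elim: b => [|b IH|f IH] Gs e eta s e0 HG.
- move=> /Rk_succ[x [s' [st Rs']]].
  exists [:: (1, (s, x, s'))], s'; split=> //=; first by rewrite /mass big_seq1.
  move=> G [|a A] inG GA; first by rewrite /hitmass big_seq1 mulr0 ltW.
  have [[_ cG] []] := HG G inG; split; first exact: cG GA (sub0seq _).
  by exists a; apply: cG GA _; rewrite /= eqxx sub0seq.
- move=> Rs.
  have [c Hc] : exists c, forall G, List.In G Gs ->
      ~ tder_iter (omul (oexp omega b) (ofnat c)) G [::].
    by apply: uniform_rank_bound => G /HG[_ /existsNP].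
  have e2 : 0 < e / 2 by rewrite divr_gt0.
  have [m m_gt0 cm] := large_multiple (ler0n R c) e2.
  have Rs' : Rk (oadd eta (omul (oexp omega b) (ofnat m))) s.
    by apply: Rk_anti Rs; apply: oadd_le2l; apply: (Ole_Lr (n := m)).
  (* Here all families stand in [Gs] from the start; the sequence of late families is filled with
     the empty one, never active. *)
  have fam0 (_ : nat) : sorted_family (fun _ : seq nat => False) by split.
  have act0 (s0 : S) : exists v, forall n : nat, false -> (n < v)%N by exists 0%N.
  have [|L [s' [mL sL Rs1 H1 _]]] :=
    few_blocks_hit (act := fun _ _ => false) IH fam0 act0 (Gs := Gs) e2 _ Rs'.
    by move=> G /HG[].
  have m0 : 0 < m%:R :> R by rewrite ltr0n.
  exists (flatten_walk m%:R^-1 L), s'; split=> //.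
  + by apply: walk_flatten mL; rewrite invr_ge0 ltW.
  + by rewrite (mass_flatten _ mL) sL mulVf // gt_eqF.
  + move=> G A inG GA; rewrite hitmass_flatten.
    rewrite mulrC ler_pdivrMr //; apply: (le_trans (H1 G A c inG GA (Hc G inG))).
    lra.
- move=> Rs.
  have [n Hn] : exists n, forall G, List.In G Gs -> ~ tder_iter (oexp omega (f n)) G [::].
    by apply: uniform_rank_bound => G /HG[_ /existsNP].
  apply: (IH n Gs e eta s e0); first by move=> G inG; split; [case: (HG G inG)|apply: Hn].
  by apply: Rk_anti Rs; apply: oadd_le2l; apply: (Ole_Lr (n := n)).
Qed.

End Averaging.

(** * The mixed Tsirelson norm *)

Lemma smin_mem (e : seq nat) : e != [::] -> smin e \in e.
Proof.
case: e => // a e _; rewrite /smin /=.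
suff H t : foldr minn a t \in a :: t.
  by case: (leqP a (foldr minn a e)) => _; [exact: mem_head|exact: H].
elim: t => [|b t IH] /=; first exact: mem_head.
case: (leqP b (foldr minn a t)) => _; first by rewrite !inE eqxx orbT.
by move: IH; rewrite !inE => /orP[->//|->]; rewrite !orbT.
Qed.

Lemma smin_le (e : seq nat) k : k \in e -> (smin e <= k)%N.
Proof.
rewrite /smin; elim: e (head _ _) => // a e IH z; rewrite inE /= geq_min.
by case/orP=> [/eqP->|/IH->]; rewrite ?leqnn ?orbT.
Qed.

Lemma set_lt_mem (e f : seq nat) j k :
  set_lt e f -> j \in e -> k \in f -> (j < k)%N.
Proof. by move=> /allP H /H /allP/(_ k). Qed.

Lemma blocks_cons e E : blocks (e :: E) ->
  [/\ e != [::], blocks E & forall f, f \in E -> f != [::] /\ set_lt e f].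
Proof.
move=> /andP[/= /andP[e0 E0] sE]; split=> //.
  by rewrite /blocks E0 (path_sorted sE).
have tr : {in e :: E & &, transitive set_lt}.
  have ne f : f \in e :: E -> f != [::] by rewrite inE => /orP[/eqP->//|/(allP E0)].
  move=> y x z /ne y0 _ _ xy yz.
  apply/allP => j jx; apply/allP => k kz.
  have ys := smin_mem y0.
  exact: ltn_trans (set_lt_mem xy jx ys) (set_lt_mem yz ys kz).
move=> f fE; split; first exact: (allP E0).
have aE : all [in e :: E] (e :: E) by apply/allP.
have /allP H := order_path_min_in tr aE sE.
exact: H.
Qed.

Lemma sorted_smin E : blocks E -> sorted ltn (map smin E).
Proof.
elim: E => // e E IH /blocks_cons[e0 /IH sE H].
rewrite /= path_min_sorted //; apply/allP => _ /mapP[f fE ->].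
have [f0 ef] := H f fE.
exact: set_lt_mem ef (smin_mem e0) (smin_mem f0).
Qed.

Section Norm.
Variables (R : realType) (F : nat -> fam) (theta : nat -> R) (N : vec R -> R).
Hypothesis F_S0 : forall n, S0_sub (F n).
Hypothesis theta01 : forall n, (0 < n)%N -> 0 < theta n /\ theta n < 1.
Hypothesis theta_dec : forall n, (0 < n)%N -> theta n.+1 <= theta n.
Hypothesis N_MT : MTnorm F theta N.

Implicit Types (x y : vec R) (e : seq nat) (E : seq (seq nat)).

Lemma theta_le1 n : (0 < n)%N -> theta n <= theta 1.
Proof.
case: n => // n _; elim: n => // n IH.
exact: le_trans (theta_dec _) IH.
Qed.

Lemma finsupp_restrict e x : finsupp x -> finsupp (restrict e x).
Proof. by move=> [m H]; exists m => k /H; rewrite /restrict; case: ifP. Qed.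

Lemma restrictC e f x : restrict e (restrict f x) = restrict f (restrict e x).
Proof. by apply: funext => k; rewrite /restrict; do 2 case: ifP. Qed.

Lemma N0 : N (zv R) = 0. Proof. by case: N_MT. Qed.

Lemma N_ge_F0 x A m : finsupp x -> F 0 A -> \sum_(k < m | A k) `|x k| <= N x.
Proof. by move=> fx FA; case: N_MT => _ /(_ x fx)[+ _]; apply; left; exists A, m. Qed.

Lemma N_ge_adm x n E : finsupp x -> (0 < n)%N -> admissible (F n) E ->
  theta n * \sum_(e <- E) N (restrict e x) <= N x.
Proof. by move=> fx n0 aE; case: N_MT => _ /(_ x fx)[+ _]; apply; right; exists n, E. Qed.

Lemma N_le x u : finsupp x ->
  (forall A m, F 0 A -> \sum_(k < m | A k) `|x k| <= u) ->
  (forall n E, (0 < n)%N -> admissible (F n) E ->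
     theta n * \sum_(e <- E) N (restrict e x) <= u) -> N x <= u.
Proof.
move=> fx H1 H2; case: N_MT => _ /(_ x fx)[_]; apply=> r.
case=> [[A [m [FA ->]]]|[n [E [n0 [aE ->]]]]]; [exact: H1|exact: H2].
Qed.

Lemma N_ge0 x : finsupp x -> 0 <= N x.
Proof.
move=> fx; apply: le_trans (N_ge_F0 0 fx (F_S0 0).1).
by rewrite big_pred0.
Qed.

(* Two different members of [E] meeting [[lo, hi)] force the minimum of the
   later one into the open interval. *)
Lemma blocks_unhit_sum (Psi : seq nat -> R) E lo hi x B : 0 <= B -> blocks E ->
  (forall k, x k != 0 -> (lo <= k < hi)%N) ->
  (forall e, e \in E -> ~~ (lo < smin e < hi)%N) ->
  (forall e, e \in E -> Psi e <= B) ->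
  (forall e, e \in E -> restrict e x = zv R -> Psi e = 0) ->
  \sum_(e <- E) Psi e <= B.
Proof.
move=> B0; elim: E => [|e E IH] bE sx; first by rewrite big_nil.
move=> Hm HB Hz; have [e0 bE' eE] := blocks_cons bE.
rewrite big_cons.
have [ez|ez] := pselect (restrict e x = zv R).
  rewrite (Hz e (mem_head _ _) ez) add0r; apply: IH => // f fE.
  + by apply: Hm; rewrite inE fE orbT.
  + by apply: HB; rewrite inE fE orbT.
  + by apply: Hz; rewrite inE fE orbT.
rewrite big_seq big1 ?addr0; first by apply: HB; rewrite mem_head.
move=> f fE; have [f0 ef] := eE f fE.
apply: Hz; first by rewrite inE fE orbT.
apply: funext => k; rewrite /restrict /zv; case: ifP => // kf.
apply/eqP/negPn/negP => /sx /andP[_ khi].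
apply: ez; apply: funext => j; rewrite /restrict /zv; case: ifP => // je.
apply/eqP/negPn/negP => /sx /andP[lj _].
have := Hm f; rewrite inE fE orbT => /(_ isT) /negP; apply.
by have := set_lt_mem ef je (smin_mem f0); have := smin_le kf; lia.
Qed.

(* [N] is the least function dominating its own defining expressions; this is
   the form of minimality that handles operations on several vectors. *)
Lemma N_minimal (I : Type) (v : I -> vec R) (rs : seq nat -> I -> I) (Psi : I -> R)
    (ok : I -> Prop) :
  (forall i, ok i -> finsupp (v i)) -> (forall e i, ok i -> ok (rs e i)) ->
  (forall e i, v (rs e i) = restrict e (v i)) -> (forall i, ok i -> 0 <= Psi i) ->
  (forall i A m, ok i -> F 0 A -> \sum_(k < m | A k) `|v i k| <= Psi i) ->
  (forall i n E, ok i -> (0 < n)%N -> admissible (F n) E ->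
     theta n * \sum_(e <- E) Psi (rs e i) <= Psi i) ->
  forall i, ok i -> N (v i) <= Psi i.
Proof.
move=> fv okr vr Psi0 PsiF Psiadm.
(* Induction on the size of a finite set carrying the support: a restriction that drops a coordinate
   of the support is covered by the induction hypothesis. *)
suff H p : forall i (s : seq nat), ok i -> (size s <= p)%N ->
    (forall k, v i k != 0 -> k \in s) -> N (v i) <= Psi i.
  move=> i oki; have [m Hm] := fv i oki.
  apply: (H m i (iota 0 m) oki); first by rewrite size_iota.
  move=> k; rewrite mem_iota /= add0n; apply: contraR; rewrite -leqNgt => /Hm->.
  by rewrite eqxx.
elim: p => [|p IH] i s oki sz ssup.
  have -> : v i = zv R.
    apply: funext => k; apply/eqP/negPn/negP => /ssup.
    by move: sz; rewrite leqn0 size_eq0 => /eqP->.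
  by rewrite N0 Psi0.
have fi := fv i oki.
have Ni0 := N_ge0 fi.
(* When one member of [E] contains the whole support, the defining expression refers back to
   [N (v i)] itself. The second entry of the maximum receives this case, and [theta 1 < 1] absorbs
   it. *)
suff : N (v i) <= Num.max (Psi i) (theta 1 * N (v i)).
  rewrite le_max => /orP[//|]; have [_ t1] := theta01 (ltn0Sn 0).
  move=> H; have : N (v i) * (1 - theta 1) <= 0 by lra.
  rewrite pmulr_lle0 ?subr_gt0 // => Ni; exact: le_trans Ni (Psi0 i oki).
apply: N_le => // [A m FA|n E n0 aE].
  by rewrite le_max (PsiF i A m).
have [bE _] := aE; have [tn0 _] := theta01 n0.
have [[e eE Hfull]|Hno] :=
  pselect (exists2 e, e \in E & forall k, v i k != 0 -> k \in e).
  rewrite le_max; apply/orP; right.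
  apply: (@le_trans _ _ (theta n * N (v i))); last first.
    by apply: ler_wpM2r => //; apply: theta_le1.
  apply: ler_wpM2l; first exact: ltW.
  have re f : f \in E -> f != e -> restrict f (v i) = zv R.
    move=> fE fe; apply: funext => k; rewrite /restrict /zv; case: ifP => // kf.
    apply/eqP/negPn/negP => /Hfull ke.
    have := bE; move: eE fE fe ke kf; clear.
    elim: E => // g E IH eE fE fe ke kf /blocks_cons[_ bE H].
    move: eE fE; rewrite !inE => /orP[/eqP eg|eE] /orP[/eqP fg|fE].
    - by rewrite eg fg eqxx in fe.
    - have [_ gf] := H f fE; rewrite eg in ke.
      by have := set_lt_mem gf ke kf; rewrite ltnn.
    - have [_ ge] := H e eE; rewrite fg in kf.
      by have := set_lt_mem ge kf ke; rewrite ltnn.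
    - exact: IH.
  have uE : uniq E.
    apply: (@map_uniq _ _ smin); apply: (sorted_uniq ltn_trans ltnn).
    exact: sorted_smin.
  rewrite (bigD1_seq e) //= [X in _ + X]big_seq_cond big1 ?addr0.
    suff -> : restrict e (v i) = v i by [].
    apply: funext => k; rewrite /restrict; case: ifP => // /negP kN.
    by apply/esym/eqP/negPn/negP => /Hfull.
  by move=> f /andP[fE fe]; rewrite re // N0.
rewrite le_max; apply/orP; left; apply: le_trans (Psiadm i n E oki n0 aE).
apply: ler_wpM2l; first exact: ltW.
rewrite big_seq [leRHS]big_seq; apply: ler_sum => e eE; rewrite -vr.
have [k Hk] : exists k, ~ (v i k != 0 -> k \in e).
  by apply/existsNP => H; apply: Hno; exists e.
have vk : v i k != 0 by apply: contra_notN Hk => /eqP->; rewrite eqxx.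
have ke : k \notin e by apply/negP => H; apply: Hk.
apply: (IH _ (rem k s)); first exact: okr.
  by rewrite size_rem ?ssup //; move: sz; case: (size s).
move=> j; rewrite vr /restrict; case: ifP => [je /ssup js|]; last by rewrite eqxx.
have jk : j != k by apply: contraNneq ke => <-.
by move: js; rewrite (perm_mem (perm_to_rem (ssup k vk))) inE (negPf jk).
Qed.

Lemma N_restrict e x : finsupp x -> N (restrict e x) <= N x.
Proof.
apply: (N_minimal (v := restrict e) (rs := @restrict R) (ok := @finsupp R)).
- by move=> i; apply: finsupp_restrict.
- by move=> f i; apply: finsupp_restrict.
- by move=> f i; apply: restrictC.
- exact: N_ge0.
- move=> i A m fi FA; apply: le_trans (N_ge_F0 m fi FA); apply: ler_sum => k _.
  by rewrite /restrict; case: ifP => // _; rewrite normr0.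
- by move=> i n E; apply: N_ge_adm.
Qed.

(** * Linear combinations and the triangle inequality *)

Definition lcomb (l : seq (R * vec R)) : vec R := fun k => \sum_(p <- l) p.1 * p.2 k.

Definition all_finsupp (l : seq (R * vec R)) := forall p, List.In p l -> finsupp p.2.

Lemma finsupp_lcomb l : all_finsupp l -> finsupp (lcomb l).
Proof.
elim: l => [|p l IH] H; first by exists 0%N => k _; rewrite /lcomb big_nil.
have [m1 H1] := H p (or_introl erefl).
have [m2 H2] := IH (fun q i => H q (or_intror i)).
exists (maxn m1 m2) => k; rewrite geq_max => /andP[k1 k2].
by rewrite /lcomb big_cons H1 // mulr0 add0r; apply: H2.
Qed.

Lemma restrict_lcomb e l :
  restrict e (lcomb l) = lcomb [seq (p.1, restrict e p.2) | p <- l].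
Proof.
apply: funext => k; rewrite /lcomb big_map /restrict /=; case: ifP => // _.
by rewrite big1 // => p _; rewrite mulr0.
Qed.

Lemma ler_sum_In (T : Type) (l : seq T) (f g : T -> R) :
  (forall p, List.In p l -> f p <= g p) -> \sum_(p <- l) f p <= \sum_(p <- l) g p.
Proof.
elim: l => [|p l IH] H; first by rewrite !big_nil.
rewrite !big_cons lerD //; first by apply: H; left.
by apply: IH => q i; apply: H; right.
Qed.

Lemma all_finsupp_restrict e l : all_finsupp l ->
  all_finsupp [seq (p.1, restrict e p.2) | p <- l].
Proof.
elim: l => [|p l IH] H q //= [<-|].
  by apply: finsupp_restrict; apply: H; left.
by apply: IH => r i; apply: H; right.
Qed.

(** The triangle inequality. As [N] is known only through its implicit equation, it comes from
    minimality, with lists of weighted vectors as indices and restriction acting on every entry. *)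
Lemma N_lcomb l : all_finsupp l -> N (lcomb l) <= \sum_(p <- l) `|p.1| * N p.2.
Proof.
apply: (N_minimal (v := lcomb) (ok := all_finsupp)
  (rs := fun e (l : seq (R * vec R)) => [seq (p.1, restrict e p.2) | p <- l])
  (Psi := fun l : seq (R * vec R) => \sum_(p <- l) `|p.1| * N p.2)).
- exact: finsupp_lcomb.
- exact: all_finsupp_restrict.
- by move=> e i; rewrite restrict_lcomb.
- move=> i H; apply: (@le_trans _ _ (\sum_(p <- i) 0)); first by rewrite big1.
  by apply: ler_sum_In => p ip; rewrite mulr_ge0 // N_ge0 //; apply: H.
- move=> i A m H FA; rewrite /lcomb.
  apply: (@le_trans _ _ (\sum_(k < m | A k) \sum_(p <- i) `|p.1| * `|p.2 k|)).
    apply: ler_sum => k _; apply: le_trans (ler_norm_sum _ _ _) _.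
    by apply: ler_sum => p _; rewrite normrM.
  rewrite exchange_big /=; apply: ler_sum_In => p ip; rewrite -mulr_sumr.
  by apply: ler_wpM2l => //; apply: N_ge_F0 => //; apply: H.
- move=> i n E H n0 aE.
  under eq_bigr do rewrite big_map /=.
  rewrite exchange_big mulr_sumr /=; apply: ler_sum_In => p ip.
  rewrite -mulr_sumr mulrCA; apply: ler_wpM2l => //.
  by apply: N_ge_adm => //; apply: H.
Qed.

Definition evec (j : nat) : vec R := fun k => (k == j)%:R.

Lemma finsupp_evec j : finsupp (evec j).
Proof. by exists j.+1 => k jk; rewrite /evec gtn_eqF. Qed.

Lemma evec_supp j k : evec j k != 0 -> (j <= k < j.+1)%N.
Proof. by rewrite /evec; have [->|_] := eqVneq k j; rewrite ?eqxx ?leqnn. Qed.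

Lemma N_evec j : N (evec j) = 1.
Proof.
have fe := finsupp_evec j.
have ge1 : 1 <= N (evec j).
  apply: le_trans (N_ge_F0 j.+1 fe ((F_S0 0).2 j)).
  by rewrite (bigD1 ord_max) //= /evec eqxx normr1 lerDl sumr_ge0.
apply/eqP; rewrite eq_le ge1 andbT.
(* At most one block contains [j], so an admissible family yields at most [theta 1 * N (evec j)],
   which cannot be the larger entry. *)
suff : N (evec j) <= Num.max 1 (theta 1 * N (evec j)).
  rewrite le_max => /orP[//|]; have [_ t1] := theta01 (ltn0Sn 0); nra.
apply: N_le => // [A m _|n E n0 [bE _]].
  rewrite le_max; apply/orP; left.
  apply: (@le_trans _ _ (\sum_(k < m) `|evec j k|)).
    by rewrite [leRHS](bigID (fun k : 'I_m => A k)) /= lerDl sumr_ge0.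
  have [jm|mj] := ltnP j m.
    rewrite (bigD1 (Ordinal jm)) //= /evec eqxx normr1 big1 ?addr0 // => k kj.
    rewrite (_ : (k == j :> nat) = false) ?normr0 //.
    by apply: contraNF kj => /eqP kj; apply/eqP/val_inj.
  rewrite big1 ?ler01 // => k _; rewrite /evec ltn_eqF ?normr0 //.
  exact: leq_trans (ltn_ord k) mj.
rewrite le_max; apply/orP; right; have [tn _] := theta01 n0.
apply: (@le_trans _ _ (theta n * N (evec j))); last first.
  by apply: ler_wpM2r; [exact: N_ge0|exact: theta_le1].
apply: ler_wpM2l; first exact: ltW.
apply: (@blocks_unhit_sum _ E j j.+1 (evec j)) => //; first exact: N_ge0.
- exact: evec_supp.
- by move=> e _; lia.
- by move=> e _; apply: N_restrict.
- by move=> e _ ->; rewrite N0.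
Qed.

Lemma sumN_unhit E lo hi x : finsupp x -> blocks E ->
  (forall k, x k != 0 -> (lo <= k < hi)%N) ->
  (forall e, e \in E -> ~~ (lo < smin e < hi)%N) ->
  \sum_(e <- E) N (restrict e x) <= N x.
Proof.
move=> fx bE sx hE; apply: (@blocks_unhit_sum _ E lo hi x) => //.
- exact: N_ge0.
- by move=> e _; apply: N_restrict.
- by move=> e _ ->; rewrite N0.
Qed.

Lemma sumN_lcomb E l : all_finsupp l ->
  \sum_(e <- E) N (restrict e (lcomb l)) <=
  \sum_(p <- l) `|p.1| * \sum_(e <- E) N (restrict e p.2).
Proof.
move=> fl.
under [leRHS]eq_bigr do rewrite mulr_sumr.
rewrite exchange_big /=; apply: ler_sum => e _.
rewrite restrict_lcomb; apply: le_trans (N_lcomb _) _; first exact: all_finsupp_restrict.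
by rewrite big_map.
Qed.

Lemma vec_evecE x m : (forall k, (m <= k)%N -> x k = 0) ->
  x = lcomb [seq (x k, evec k) | k <- iota 0 m].
Proof.
move=> H; apply: funext => k; rewrite /lcomb big_map /=.
have [km|mk] := ltnP k m.
  rewrite (bigD1_seq k) ?iota_uniq ?mem_iota //= /evec eqxx mulr1 big1 ?addr0 //.
  by move=> j; rewrite eq_sym => /negPf->; rewrite mulr0.
rewrite H // big_seq big1 // => j; rewrite mem_iota /evec => /andP[_ jm].
by rewrite gtn_eqF ?mulr0 //; lia.
Qed.

(** Each unit vector has norm one and meets at most one block. This crude bound serves for blocks
    chosen before an index becomes active. *)
Lemma sumN_l1 E x m : blocks E -> (forall k, (m <= k)%N -> x k = 0) ->
  \sum_(e <- E) N (restrict e x) <= \sum_(0 <= k < m) `|x k|.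
Proof.
move=> bE H; rewrite {1}(vec_evecE H).
apply: le_trans (sumN_lcomb _ _) _.
  elim: (iota 0 m) => [|k r IH] p //= [<-|]; [exact: finsupp_evec|exact: IH].
rewrite big_map /index_iota subn0; apply: ler_sum => k _ /=.
rewrite ler_piMr // -(N_evec k); apply: (@sumN_unhit _ k k.+1) => //.
- exact: finsupp_evec.
- exact: evec_supp.
- by move=> e _; lia.
Qed.

End Norm.

(** * Upper estimate *)

Lemma sum_nth_seq (R : realType) (T : Type) (d : T) (l : seq T) (g : T -> R) :
  \sum_(i < size l) g (nth d l i) = \sum_(p <- l) g p.
Proof. by rewrite (big_nth d) big_mkord. Qed.

Lemma In_nth (T : Type) (d : T) (s : seq T) x :
  List.In x s -> exists2 i, (i < size s)%N & nth d s i = x.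
Proof.
elim: s => // a s IH /= [->|/IH[i si <-]]; first by exists 0%N.
by exists i.+1.
Qed.

Section VectorTop.
Variable R : realType.
Implicit Types x : vec R.

(** The least bound of the support, extracted classically; the value 0 is a default for vectors of
    infinite support. *)
Definition vtop x : nat :=
  if pselect (exists m, `[< forall k, (m <= k)%N -> x k = 0 >]) is left h
  then ex_minn h else 0%N.

Lemma vtop_supp x k : finsupp x -> (vtop x <= k)%N -> x k = 0.
Proof.
move=> [m Hm]; rewrite /vtop; case: pselect => [h|[]]; last by exists m; apply/asboolP.
by case: ex_minnP => n /asboolP Hn _; apply: Hn.
Qed.

Lemma vtop_le x m : (forall k, (m <= k)%N -> x k = 0) -> (vtop x <= m)%N.
Proof.
move=> Hm; rewrite /vtop; case: pselect => // h.
by case: ex_minnP => n _; apply; apply/asboolP.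
Qed.

(** The default [zv R] gives the empty node top 0. *)
Definition node_top (s : seq (vec R)) : nat := vtop (last (zv R) s).

Definition l1norm x : R := \sum_(0 <= k < vtop x) `|x k|.

Definition node_l1 (s : seq (vec R)) : R := \sum_(x <- s) l1norm x.

Lemma l1norm_ge0 x : 0 <= l1norm x. Proof. exact: sumr_ge0. Qed.

Lemma node_l1_ge0 s : 0 <= node_l1 s.
Proof. by apply: sumr_ge0 => x _; apply: l1norm_ge0. Qed.

End VectorTop.
Arguments node_top {R} s.

(** The derivative of order [a] still contains the empty set and only the next one is empty; [c.+1]
    makes room for it. *)
Lemma iota_rank_lt G b c a : regular G -> iota_is G a ->
  Ole a (omul (oexp omega b) (ofnat c)) ->
  ~ tder_iter (omul (oexp omega b) (ofnat c.+1)) (family_tree G) [::].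
Proof.
move=> rG iG ac H.
have : tder_iter (OS a) (family_tree G) [::].
  apply: tder_iter_anti H; apply: (@Ole_trans (OS (omul (oexp omega b) (ofnat c)))).
    exact: Ole_SS.
  by apply: (@oadd_le2l _ (OS OZ)); apply: oexp_ge1.
case=> _ [k /(tder_iter_cb rG) /iG /(_ k)].
by rewrite inE eqxx.
Qed.

(** * Convex blocks inside a fixed [l1] tree *)

Section Upper.
Variables (R : realType) (F : nat -> fam) (theta : nat -> R) (N : vec R -> R).
Hypothesis F_hered : forall n, hereditary (F n).
Hypothesis F_S0 : forall n, S0_sub (F n).
Hypothesis theta01 : forall n, (0 < n)%N -> 0 < theta n /\ theta n < 1.
Hypothesis theta_dec : forall n, (0 < n)%N -> theta n.+1 <= theta n.
Hypothesis theta_null : forall e : R, 0 < e -> exists M, forall n, (M <= n)%N -> theta n < e.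
Hypothesis N_MT : MTnorm F theta N.
Variables (K : R) (T : seq (vec R) -> Prop).
Hypothesis T_l1 : l1_tree N K T.

Let T_node s : T s -> l1_block_node N K s. Proof. by case: T_l1 => H _; apply: H. Qed.
Let T_prefix : prefix_closed T. Proof. by case: T_l1. Qed.

Lemma node_In s x : T s -> List.In x s -> finsupp x /\ N x = 1.
Proof.
move=> /T_node[H _ _] /(In_nth (zv R))[i si <-]; exact: H.
Qed.

Lemma node_rcons s x : T (rcons s x) -> [/\ finsupp x, N x = 1 &
  forall k, x k != 0 -> (node_top s <= k < node_top (rcons s x))%N].
Proof.
move=> Tx; have [fx Nx] : finsupp x /\ N x = 1.
  by apply: (node_In Tx); rewrite -cats1; apply/List.in_app_iff; right; left.
split=> // k xk; apply/andP; split; last first.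
  by rewrite /node_top last_rcons ltnNge; apply: contra_neqN xk => /(vtop_supp fx).
case/lastP: s Tx => [|s y] Tx; first by apply: vtop_le => j; rewrite /node_top.
apply: vtop_le => j kj; rewrite last_rcons.
apply/eqP/negPn/negP => yj.
have [_ + _] := T_node Tx => /(_ (size s) j k).
rewrite !size_rcons ltnS leqnn !nth_rcons !size_rcons ltnSn ltnn eqxx ltnn eqxx.
by move=> /(_ isT yj xk); rewrite ltnNge kj.
Qed.

Lemma node_top_rcons s x : T (rcons s x) -> (node_top s <= node_top (rcons s x))%N.
Proof.
move=> Tx; have [fx Nx sx] := node_rcons Tx.
have [[k xk]|H] := pselect (exists k, x k != 0).
  by have := sx k xk; lia.
suff x0 : x = zv R by have := Nx; rewrite x0 (N0 N_MT) => /esym/eqP; rewrite oner_eq0.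
by apply: funext => k; apply/eqP/negPn/negP => xk; apply: H; exists k.
Qed.

(** Convex blocks are the case [t = 1]; general [t] accommodates the partial sums of a walk. *)
Definition cone (s s' : seq (vec R)) (t : R) (y : vec R) : Prop :=
  exists l : seq (R * vec R), [/\ s' = s ++ map snd l,
    forall p, List.In p l -> 0 <= p.1, \sum_(p <- l) p.1 = t & y = lcomb l].

Lemma cone_In s (l : seq (R * vec R)) p : T (s ++ map snd l) -> List.In p l ->
  [/\ finsupp p.2, N p.2 = 1 &
   forall k, p.2 k != 0 -> (node_top s <= k < node_top (s ++ map snd l))%N].
Proof.
move=> Ts inp.
suff [] : (node_top s <= node_top (s ++ map snd l))%N /\
  forall p, List.In p l -> [/\ finsupp p.2, N p.2 = 1 &
   forall k, p.2 k != 0 -> (node_top s <= k < node_top (s ++ map snd l))%N].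
  by move=> _; apply.
elim: l s Ts {p inp} => [|q l IH] s /=; first by rewrite cats0.
rewrite -cat_rcons => Ts; have [le1 H1] := IH _ Ts.
have Tq : T (rcons s q.2).
  by have := T_prefix (size (rcons s q.2)) Ts; rewrite take_size_cat.
have le2 := node_top_rcons Tq; have [fq Nq sq] := node_rcons Tq.
split=> [|p [<-|/H1[fp Np sp]]]; first exact: leq_trans le2 le1.
  by split=> // k /sq; lia.
by split=> // k /sp; lia.
Qed.

Lemma cone_top s s' t y : T s' -> cone s s' t y -> (node_top s <= node_top s')%N.
Proof.
move=> Ts [l [Es _ _ _]]; move: Ts; rewrite {}Es.
elim: l s => [|q l IH] s /=; first by rewrite cats0.
rewrite -cat_rcons => Ts.
have Tq : T (rcons s q.2).
  by have := T_prefix (size (rcons s q.2)) Ts; rewrite take_size_cat.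
exact: leq_trans (node_top_rcons Tq) (IH _ Ts).
Qed.

Lemma cone_facts s s' t y : T s' -> cone s s' t y -> [/\ finsupp y, N y <= t &
  forall k, y k != 0 -> (node_top s <= k < node_top s')%N].
Proof.
move=> Ts [l [Es l0 lt ->]]; rewrite Es in Ts *.
have fl : all_finsupp l by move=> p /(cone_In Ts)[].
split; first exact: finsupp_lcomb.
  apply: le_trans (N_lcomb F_S0 theta01 theta_dec N_MT fl) _.
  rewrite -lt; apply: ler_sum_In => p pl; have [_ -> _] := cone_In Ts pl.
  by rewrite mulr1 ger0_norm // l0.
move=> k; apply: contra_neqT => Hk; rewrite /lcomb.
suff H (r : seq (R * vec R)) : (forall p, List.In p r -> p.2 k = 0) -> \sum_(p <- r) p.1 * p.2 k = 0.
  apply: H => p /(cone_In Ts)[_ _ H]; apply/eqP/negPn/negP => /H; exact/negP.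
elim: r => [|p r IH] H; first by rewrite big_nil.
rewrite big_cons (H p (or_introl erefl)) mulr0 add0r.
by apply: IH => q i; apply: H; right.
Qed.

(** This lower bound holds for every convex block, however often averages are taken; the upper
    estimate ends by contradicting it. *)
Lemma cone_l1 s s' t y : T s' -> cone s s' t y -> K^-1 * t <= N y.
Proof.
move=> Ts [l [Es l0 lt ->]].
(* Coefficients are extended by zero to [s], so that the [l1] estimate of the node [s'] applies. *)
pose r := [seq (0 : R, x) | x <- s] ++ l.
have Er : s' = map snd r by rewrite Es /r map_cat -map_comp map_id.
have [_ _ /(_ (fun i => (nth (0, zv R) r i).1))] := T_node Ts.
have sz : size s' = size r by rewrite Er size_map.
have Esum : \sum_(i < size r) `|(nth (0, zv R) r i).1| = \sum_(p <- r) `|p.1|.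
  exact: (sum_nth_seq _ _ (fun p : R * vec R => `|p.1|)).
rewrite sz Esum.
have -> : \sum_(p <- r) `|p.1| = t.
  rewrite /r big_cat big_map /= normr0 big1 // add0r -lt.
  elim: l l0 {Es lt r Er sz Esum} => [|p l IH] l0; first by rewrite !big_nil.
  rewrite !big_cons IH ?ger0_norm // => [|q i]; last by apply: l0; right.
  by apply: l0; left.
suff -> : (fun k => \sum_(i < size r) (nth (0, zv R) r i).1 * nth (zv R) s' i k) = lcomb l.
  by [].
apply: funext => k.
rewrite (eq_bigr (fun i : 'I_(size r) => (fun p => p.1 * p.2 k) (nth (0, zv R) r i))).
  rewrite (sum_nth_seq (0, zv R) r (fun p => p.1 * p.2 k)) /r big_cat big_map /= big1 ?add0r // => x _.
  by rewrite mul0r.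
by move=> i _; rewrite Er (nth_map (0, zv R)).
Qed.

Lemma cone_cat s1 s2 s3 t t' y y' : cone s1 s2 t y -> cone s2 s3 t' y' ->
  cone s1 s3 (t + t') (fun k => y k + y' k).
Proof.
move=> [l [-> l0 lt ->]] [l' [-> l0' lt' ->]]; exists (l ++ l'); split.
- by rewrite map_cat catA.
- by move=> p /List.in_app_iff[/l0|/l0'].
- by rewrite big_cat /= lt lt'.
- by apply: funext => k; rewrite /lcomb big_cat.
Qed.

Lemma cone_scale s s' t y a : 0 <= a -> cone s s' t y ->
  cone s s' (a * t) (fun k => a * y k).
Proof.
move=> a0 [l [-> l0 lt ->]]; exists [seq (a * p.1, p.2) | p <- l]; split.
- by rewrite -map_comp.
- by move=> q /List.in_map_iff[p [<- /l0 p0]]; rewrite mulr_ge0.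
- by rewrite big_map -mulr_sumr lt.
- apply: funext => k; rewrite /lcomb big_map mulr_sumr.
  by apply: eq_bigr => p _; rewrite mulrA.
Qed.

Notation wstep := (R * (seq (vec R) * vec R * seq (vec R)))%type.

Definition walk_sum (l : seq wstep) : vec R :=
  lcomb [seq (p.1, p.2.1.2) | p <- l].

Section Steps.
Variable step : seq (vec R) -> vec R -> seq (vec R) -> Prop.
Hypothesis step_cone : forall s y s', step s y s' -> T s' /\ cone s s' 1 y.

Lemma step_top s y s' : step s y s' -> (node_top s <= node_top s')%N.
Proof. by move=> /step_cone[Ts']; apply: cone_top. Qed.

Lemma walk_cone s l s' : T s -> walk step s l s' ->
  T s' /\ cone s s' (mass l) (walk_sum l).
Proof.
rewrite /mass /walk_sum; elim: l s => [|p l IH] s Ts /=.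
  move=> <-; split=> //; exists [::]; split=> //; first by rewrite cats0.
  by rewrite !big_nil.
case=> ps p0 /step_cone[Tp cp] /(IH _ Tp)[Ts' cl]; split=> //.
have := cone_cat (cone_scale p0 cp) cl; rewrite mulr1 big_cons.
congr cone; apply: funext => k.
by rewrite /lcomb /= big_cons.
Qed.

Lemma walk_sum_finsupp s l s' : walk step s l s' ->
  all_finsupp [seq (p.1, p.2.1.2) | p <- l].
Proof.
move=> wl q /List.in_map_iff[p [<- /(walk_In wl)[_ /step_cone[Tp cp]]]].
by case: (cone_facts Tp cp).
Qed.

Lemma walk_sumN n E s l s' (g : seq (vec R) * vec R * seq (vec R) -> R) :
  (0 < n)%N -> walk step s l s' ->
  (forall p, List.In p l ->
     theta n * \sum_(e <- E) N (restrict e p.2.1.2) <= g p.2) ->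
  theta n * \sum_(e <- E) N (restrict e (walk_sum l)) <= \sum_(p <- l) p.1 * g p.2.
Proof.
move=> n0 wl H; have [tn _] := theta01 n0.
apply: (@le_trans _ _ (theta n *
  \sum_(p <- l) p.1 * \sum_(e <- E) N (restrict e p.2.1.2))).
  apply: ler_wpM2l; first exact: ltW.
  apply: le_trans (sumN_lcomb F_S0 theta01 theta_dec N_MT E (walk_sum_finsupp wl)) _.
  rewrite big_map; apply: ler_sum_In => p pl /=.
  by have [p0 _] := walk_In wl pl; rewrite ger0_norm.
rewrite mulr_sumr; apply: ler_sum_In => p pl; have [p0 _] := walk_In wl pl.
by rewrite mulrCA; apply: ler_wpM2l => //; apply: H.
Qed.

Lemma walk_sumF0 (A : nat -> bool) m s l s' (g : seq (vec R) * vec R * seq (vec R) -> R) :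
  walk step s l s' ->
  (forall p, List.In p l -> \sum_(k < m | A k) `|p.2.1.2 k| <= g p.2) ->
  \sum_(k < m | A k) `|walk_sum l k| <= \sum_(p <- l) p.1 * g p.2.
Proof.
move=> wl H.
apply: (@le_trans _ _ (\sum_(k < m | A k) \sum_(p <- l) `|p.1 * p.2.1.2 k|)).
  apply: ler_sum => k _; rewrite /walk_sum /lcomb big_map; exact: ler_norm_sum.
rewrite exchange_big /=; apply: ler_sum_In => p pl; have [p0 _] := walk_In wl pl.
under eq_bigr do rewrite normrM (ger0_norm p0).
by rewrite -mulr_sumr; apply: ler_wpM2l => //; apply: H.
Qed.

Lemma step_adm_le s y s' n E : step s y s' -> (0 < n)%N -> admissible (F n) E ->
  theta n * \sum_(e <- E) N (restrict e y) <= 1.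
Proof.
move=> /step_cone[Ts' cy] n0 aE; have [fy Ny _] := cone_facts Ts' cy.
exact: le_trans (N_ge_adm N_MT fy n0 aE) Ny.
Qed.

Lemma step_unhit s y s' E : step s y s' -> blocks E ->
  ~~ hit node_top (map smin E) (s, y, s') ->
  \sum_(e <- E) N (restrict e y) <= N y.
Proof.
move=> /step_cone[Ts' cy] bE hE; have [fy Ny sy] := cone_facts Ts' cy.
apply: (sumN_unhit F_S0 theta01 theta_dec N_MT fy bE sy) => e eE.
apply: contra hE => /andP[lo hi]; apply/hasP; exists (smin e).
  by apply/mapP; exists e.
by rewrite /= (ltnW lo).
Qed.

End Steps.

(** * Good vectors and the rounds of averaging *)

Section Levels.
Variables (e : R) (n0 : nat).
Hypotheses (e_gt0 : 0 < e) (n0_gt0 : (0 < n0)%N).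

Definition smallF0 (y : vec R) : Prop :=
  forall A m, F 0 A -> \sum_(k < m | A k) `|y k| <= e.

Definition smallTail (y : vec R) : Prop :=
  forall n E, (n0 <= n)%N -> admissible (F n) E ->
    theta n * \sum_(f <- E) N (restrict f y) <= e.

(** [smallF0] and [smallTail] pass to averages, so they are secured once; later rounds only have to
    lower [rho] against the indices below [n0]. *)
Definition good (rho : R) s y s' : Prop :=
  [/\ T s', cone s s' 1 y, smallF0 y, smallTail y & N y <= rho].

(** [delta] is the price of one good vector and [eta] what remains, so that good vectors can be
    taken one after another. *)
Definition attains (delta : Ord) (rho : R) : Prop :=
  forall eta s, tder_iter (oadd eta delta) T s ->
    exists y s', good rho s y s' /\ tder_iter eta T s'.

(** For an index below [n0], an admissible family leaves most of the [M] vectors unhit. An unhit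
    vector contributes at most [theta 1 * rho], a hit one at most 1, and the average mass of the hit
    ones is at most [e]. *)
Lemma attains_improve delta rho b c : 0 <= rho -> attains delta rho ->
  (forall n, (0 < n < n0)%N ->
     ~ tder_iter (omul (oexp omega b) (ofnat c)) (family_tree (F n)) [::]) ->
  exists M, attains (omul delta (omul (oexp omega b) (ofnat M))) (theta 1 * rho + e).
Proof.
move=> rho0 att rk.
have e2 : 0 < e / 2 by rewrite divr_gt0.
have [M M0 cM] := large_multiple (ler0n R c) e2.
exists M => eta s Ds.
have Ts : T s := tder_iter_sub Ds.
(* One step of the new walk is a good vector, so rank is counted in multiples of [delta]. *)
pose Rk g := tder_iter (oadd eta (omul delta g)) T.
have Rk_anti a a' s0 : Ole a a' -> Rk a' s0 -> Rk a s0.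
  by move=> aa; apply: tder_iter_anti; apply/oadd_le2l/omul_le2l.
have Rk_succ a s0 : Rk (OS a) s0 -> exists y s', good rho s0 y s' /\ Rk a s'.
  by rewrite /Rk /= oaddA => /att.
have step_cone s0 y s' : good rho s0 y s' -> T s' /\ cone s0 s' 1 y by case.
have stop := step_top step_cone.
(* All indices from 1 to [n0 - 1] are active at once; the shift by one leaves out [F 0], settled by
   [smallF0]. *)
pose act n (_ : seq (vec R)) := (n.+1 < n0)%N.
have fact s0 : exists v, forall n, act n s0 -> (n < v)%N.
  by exists n0 => n /ltnW.
have [|||L [s' [mL sL Rs' _ HL]]] := few_blocks_hit (eta := OZ) (Gs := [::])
  (F := fun n => family_tree (F n.+1)) stop
  (small_averages stop Rk_anti Rk_succ (b := b)) _ fact e2 _ (s := s) (m := M).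
- by move=> n; apply: sorted_family_tree.
- by [].
- by rewrite oadd0.
have M0' : 0 < M%:R :> R by rewrite ltr0n.
have iM0 : 0 <= M%:R^-1 :> R by rewrite invr_ge0 ltW.
pose l := flatten_walk M%:R^-1 L; pose y := walk_sum l.
have wl : walk (good rho) s l s' := walk_flatten iM0 mL.
have ml : mass l = 1 by rewrite (mass_flatten _ mL) sL mulVf // gt_eqF.
have [Ts' cy] := walk_cone step_cone Ts wl; rewrite ml in cy.
have [fy _ _] := cone_facts Ts' cy.
have sum_cst a : \sum_(p <- l) p.1 * a = a by rewrite -mulr_suml [X in X * _]ml mul1r.
have yF0 : smallF0 y.
  move=> A m FA; rewrite -(sum_cst e); apply: (walk_sumF0 (g := fun _ => e) wl) => p pl.
  by have [_ [_ _ H _ _]] := walk_In wl pl; apply: H.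
have yTail : smallTail y.
  move=> n E n0n aE; rewrite -(sum_cst e).
  apply: (walk_sumN step_cone (g := fun _ => e) _ wl) => [|p pl].
    exact: leq_trans n0n.
  by have [_ [_ _ _ H _]] := walk_In wl pl; apply: H.
exists y, s'; split; last by move: Rs'; rewrite /Rk.
have [t10 _] := theta01 (ltn0Sn 0).
have tr0 : 0 <= theta 1 * rho by rewrite mulr_ge0 // ltW.
split=> //; apply: (N_le N_MT fy) => [A m FA|n E n_gt0 aE].
  by apply: le_trans (yF0 A m FA) _; rewrite lerDr.
have [n0n|nn0] := leqP n0 n.
  by apply: le_trans (yTail n E n0n aE) _; rewrite lerDr.
pose A := map smin E.
have [bE FE] := aE.
apply: (@le_trans _ _ (\sum_(p <- l) p.1 * ((hit node_top A p.2)%:R + theta 1 * rho))).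
  apply: (walk_sumN step_cone (g := fun q => (hit node_top A q)%:R + theta 1 * rho)
    n_gt0 wl) => p pl.
  have [_ st] := walk_In wl pl.
  case: (boolP (hit node_top A p.2)) => hp /=.
    by apply: le_trans (step_adm_le step_cone st n_gt0 aE) _; rewrite lerDl.
  rewrite add0r; have [tn _] := theta01 n_gt0.
  apply: (@le_trans _ _ (theta n * N p.2.1.2)).
    apply: ler_wpM2l; first exact: ltW.
    by apply: (step_unhit step_cone st bE); move: hp; case: (p.2) => -[].
  have [Tp cp _ _ Np] := st; have [fp _ _] := cone_facts Tp cp.
  apply: ler_pM => //; [exact: ltW|exact: N_ge0 F_S0 N_MT _ fp|exact: theta_le1].
under eq_bigr do rewrite mulrDr.
rewrite big_split /= sum_cst addrC lerD2l.
rewrite -/(hitmass node_top A l) hitmass_flatten mulrC ler_pdivrMr //.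
have EA : family_tree (F n.-1.+1) A.
  by rewrite prednK //; split=> //; apply: sorted_smin.
have := HL n.-1 A c EA; rewrite /act prednK // nn0 => H.
apply: le_trans (H _) _; first by apply: rk; rewrite n_gt0.
lra.
Qed.

(** Steps are single vectors of the tree. An index [n] matters only after the [l1] norm collected so
    far is large against [1 / theta n]; from then on its sets are charged by [few_blocks_hit], and
    unhit vectors cost at most [theta n], which is small. *)
Lemma attains_base b c :
  (forall n, ~ tder_iter (omul (oexp omega b) (ofnat c)) (family_tree (F n)) [::]) ->
  (forall n, (n0 <= n)%N -> theta n <= e / 6) ->
  exists M, attains (omul (oexp omega b) (ofnat M)) 1.
Proof.
move=> rk tsmall.
have e6 : 0 < e / 6 by rewrite divr_gt0.
have e2 : 0 < e / 2 by rewrite divr_gt0.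
have c1 : 0 <= c%:R + 1 :> R by rewrite addr_ge0.
(* [c] allows for the fully hit blocks and 1 for the block during which an index becomes active.
   Their share is at most [e / 2], and two errors [e / 6] per block still fit. *)
have [M M0 cM] := large_multiple c1 e2.
exists M => eta s Ds.
have Ts : T s := tder_iter_sub Ds.
pose step s y s' := s' = rcons s y /\ T s'.
pose Rk g := tder_iter g T.
have Rk_anti a a' s0 : Ole a a' -> Rk a' s0 -> Rk a s0.
  by move=> aa; apply: tder_iter_anti.
have Rk_succ a s0 : Rk (OS a) s0 -> exists y s', step s0 y s' /\ Rk a s'.
  move=> [_ [x Hx]]; exists x, (rcons s0 x); split=> //; split=> //.
  exact: tder_iter_sub Hx.
have step_cone s0 y s' : step s0 y s' -> T s' /\ cone s0 s' 1 y.
  move=> [-> Ty]; split=> //; exists [:: (1, y)]; split.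
  - by rewrite cats1.
  - by move=> p [<-|//].
  - by rewrite big_seq1.
  - by apply: funext => k; rewrite /lcomb big_seq1 mul1r.
have stop := step_top step_cone.
(* The [F_0] part of the norm carries no factor [theta], so index 0 is active from the start. *)
pose act n s := (n == 0)%N || (e / 6 < theta n * node_l1 s).
have fact s0 : exists v, forall n, act n s0 -> (n < v)%N.
  have L0 := node_l1_ge0 s0.
  have [|v Hv] := theta_null (e := e / 6 / (node_l1 s0 + 1)).
    by rewrite divr_gt0 // ltr_wpDl.
  exists v.+1 => n /orP[/eqP->//|]; rewrite ltnS; apply: contraTT.
  rewrite -ltnNge -leNgt => vn; have := Hv n (ltnW vn).
  rewrite ltr_pdivlMr ?ltr_wpDl // => H; have [|tn _] := theta01 (n := n); first by lia.
  by lra.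
have [||L [s' [mL sL Rs' _ HL]]] := few_blocks_hit (eta := eta) (Gs := [::])
  (F := fun n => family_tree (F n)) stop
  (small_averages stop Rk_anti Rk_succ (b := b)) _ fact e6 _ Ds.
- by move=> n; apply: sorted_family_tree.
- by [].
have M0' : 0 < M%:R :> R by rewrite ltr0n.
have iM0 : 0 <= M%:R^-1 :> R by rewrite invr_ge0 ltW.
pose l := flatten_walk M%:R^-1 L; pose y := walk_sum l.
have wl : walk step s l s' := walk_flatten iM0 mL.
have ml : mass l = 1 by rewrite (mass_flatten _ mL) sL mulVf // gt_eqF.
have [Ts' cy] := walk_cone step_cone Ts wl; rewrite ml in cy.
have [fy Ny _] := cone_facts Ts' cy.
have st_node s0 x s1 : step s0 x s1 -> [/\ finsupp x, N x = 1,
    (forall k, x k != 0 -> (node_top s0 <= k < node_top s1)%N) & l1norm x <= node_l1 s1].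
  move=> [-> Tx]; have [fx Nx sx] := node_rcons Tx; split=> //.
  by rewrite /node_l1 -cats1 big_cat big_seq1 /= lerDr node_l1_ge0.
have l1_mono s0 (l0 : seq wstep) s1 : walk step s0 l0 s1 -> node_l1 s0 <= node_l1 s1 /\
    forall p, List.In p l0 -> l1norm p.2.1.2 <= node_l1 s1.
  elim: l0 s0 => [|p l0 IH] s0 /=; first by move=> ->.
  case=> _ _ st /IH[le1 H1]; have [_ _ _ le2] := st_node _ _ _ st.
  split; last by move=> q [<-|/H1//]; apply: le_trans le1.
  apply: le_trans le1; case: st => -> _.
  by rewrite /node_l1 -cats1 big_cat big_seq1 /= lerDl l1norm_ge0.
exists y, s'; split=> //; split=> //.
  move=> A m FA; pose B := [seq k <- iota 0 m | A k].
  have memB k : (k \in B) = A k && (k < m)%N by rewrite mem_filter mem_iota.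
  apply: (@le_trans _ _ (\sum_(p <- l) p.1 * (hit node_top B p.2)%:R)).
    apply: (walk_sumF0 (g := fun q => (hit node_top B q)%:R) wl) => p pl.
    have [_ /st_node[fx Nx sx _]] := walk_In wl pl.
    case: (boolP (hit node_top B p.2)) => hp /=.
      by rewrite -Nx; apply: (N_ge_F0 N_MT).
    rewrite big1 // => k Ak; apply/eqP; rewrite normr_eq0; apply: contraNT hp => /sx xk.
    by apply/hasP; exists (k : nat) => //; rewrite memB Ak /=.
  rewrite -/(hitmass node_top B l) hitmass_flatten mulrC ler_pdivrMr //.
  have FB : family_tree (F 0) B.
    split; first by apply: sorted_filter; [exact: ltn_trans|exact: iota_ltn_sorted].
    by apply: F_hered FA _ => k; rewrite memB => /andP[].
  have := HL 0%N B c FB (rk 0%N); rewrite (eq_bigl xpredT) // => H.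
  by apply: le_trans H _; lra.
move=> n E n0n aE.
have n_gt0 : (0 < n)%N := leq_trans n0_gt0 n0n.
have [tn _] := theta01 n_gt0; have tn6 := tsmall n n0n.
have [bE FE] := aE.
pose A := map smin E.
pose V (q : seq (vec R) * vec R * seq (vec R)) :=
  theta n * \sum_(f <- E) N (restrict f q.1.2).
have sum_cst (l0 : seq wstep) a : mass l0 = 1 -> \sum_(p <- l0) p.1 * a = a.
  by move=> m0; rewrite -mulr_suml [X in X * _]m0 mul1r.
have V1 s0 (l0 : seq wstep) s1 : walk step s0 l0 s1 -> \sum_(p <- l0) p.1 * V p.2 <= mass l0.
  move=> w0; apply: ler_sum_In => p pl; have [p0 st] := walk_In w0 pl.
  by rewrite ler_piMr //; apply: step_adm_le st n_gt0 aE.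
have Vhit s0 (l0 : seq wstep) s1 : walk step s0 l0 s1 -> mass l0 = 1 ->
    \sum_(p <- l0) p.1 * V p.2 <= hitmass node_top A l0 + e / 6.
  move=> w0 m0; rewrite -(sum_cst l0 (e / 6) m0) -big_split /=.
  apply: ler_sum_In => p pl; have [p0 st] := walk_In w0 pl.
  rewrite -mulrDr; apply: ler_wpM2l => //.
  case: (boolP (hit node_top A p.2)) => hp /=.
    by apply: le_trans (step_adm_le step_cone st n_gt0 aE) _; rewrite lerDl; apply: ltW.
  rewrite add0r; have [fx Nx _ _] := st_node _ _ _ st.
  apply: le_trans tn6; rewrite -[leRHS]mulr1 -Nx; apply: ler_wpM2l; first exact: ltW.
  by apply: (step_unhit step_cone st bE); move: hp; case: (p.2) => -[].
have Vinact s0 (l0 : seq wstep) s1 : walk step s0 l0 s1 -> mass l0 = 1 -> ~~ act n s1 ->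
    \sum_(p <- l0) p.1 * V p.2 <= e / 6.
  move=> w0 m0; rewrite /act negb_or -leNgt => /andP[_ na].
  rewrite -(sum_cst l0 (e / 6) m0).
  apply: ler_sum_In => p pl; have [p0 st] := walk_In w0 pl.
  apply: ler_wpM2l => //; apply: le_trans na; apply: ler_wpM2l; first exact: ltW.
  have [_ /(_ p pl) le1] := l1_mono _ _ _ w0; apply: le_trans le1.
  have [fx _ _ _] := st_node _ _ _ st.
  apply: (sumN_l1 F_S0 theta01 theta_dec N_MT bE) => k.
  exact: vtop_supp.
have act_mono s0 (l0 : seq wstep) s1 : walk step s0 l0 s1 -> act n s0 -> act n s1.
  move=> /l1_mono[le1 _] /orP[H|H]; apply/orP; [by left|right].
  by apply: (lt_le_trans H); apply: ler_wpM2l => //; apply: ltW.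
(* A block ending inactive is small by its [l1] norm, and a block starting active is controlled by
   its hits. At most one block remains, where [n] becomes active; it costs at most 1, recorded by
   [(~~ act n s0)%:R]. *)
have key s0 L0 s1 : multiwalk step s0 L0 s1 ->
    \sum_(q <- L0) \sum_(p <- q.2) p.1 * V p.2 <=
    (~~ act n s0)%:R + \sum_(q <- L0 | act n q.1) hitmass node_top A q.2 +
    (size L0)%:R * (e / 6).
  elim: L0 s0 => [|q L0 IH] s0 /=; first by rewrite !big_nil mul0r !addr0.
  case=> qs mq [s2 [w0 /IH H]]; rewrite !big_cons qs -natr1 mulrDl mul1r.
  have h1 := V1 _ _ _ w0; have h2 := Vhit _ _ _ w0 mq.
  have h3 := Vinact _ _ _ w0 mq; have h4 := act_mono _ _ _ w0.
  rewrite mq in h1.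
  case: (boolP (act n s0)) h4 => a0 h4 /=.
    by move: H; rewrite (h4 isT) /=; lra.
  case: (boolP (act n s2)) H h3 => a2 /= H h3; first by lra.
  by have {}h3 := h3 isT; lra.
apply: (@le_trans _ _ (\sum_(p <- l) p.1 * V p.2)).
  exact: (walk_sumN step_cone (g := V) n_gt0 wl).
rewrite sum_flatten mulrC ler_pdivrMr //.
apply: le_trans (key _ _ _ mL) _; rewrite sL.
have FA : family_tree (F n) A by split=> //; apply: sorted_smin.
have H := HL n A c FA (rk n).
have h1 : (~~ act n s)%:R <= 1 :> R by case: (act n s); rewrite /= ?ler01 ?lexx.
lra.
Qed.

End Levels.

End Upper.

Lemma omax_ub_l a b : Ole a (omax a b). Proof. exact: (Ole_Lr (n := 0)). Qed.

Lemma omax_ub_r a b : Ole b (omax a b). Proof. exact: (Ole_Lr (n := 1)). Qed.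

Lemma omax_lub a b c : Ole a c -> Ole b c -> Ole (omax a b) c.
Proof. by move=> ac bc; apply: Ole_Ll => -[|n]. Qed.

Lemma Ib_upper (R : realType) (F : nat -> fam) (theta : nat -> R)
    (alpha : nat -> Ord) (N : vec R -> R) :
  (forall n, regular (F n)) ->
  (forall n, S0_sub (F n)) ->
  (forall n, (0 < n)%N -> 0 < theta n /\ theta n < 1) ->
  (forall n, (0 < n)%N -> theta n.+1 <= theta n) ->
  (forall e : R, 0 < e -> exists M, forall n, (M <= n)%N -> theta n < e) ->
  (forall n, iota_is (F n) (alpha n)) ->
  (forall n, (0 < n)%N -> Olt (ofnat 1) (alpha n)) ->
  (forall n, (0 < n)%N -> Ole (alpha n) (alpha n.+1)) ->
  MTnorm F theta N ->
  Ib_le N (omul (omax (alpha 0%N) (OL (fun n => alpha n.+1)))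
                (OL (fun n => oexp (alpha n.+1) omega))).
Proof.
move=> F_reg F_S0 theta01 theta_dec theta_null F_iota alpha2 alpha_mono N_MT.
move=> K T K1 T_l1 s0.
have T_prefix : prefix_closed T by case: T_l1.
rewrite treeD_iterE // => Ds.
set a' := omax _ _ in Ds.
have F_hered n : hereditary (F n) by case: (F_reg n).
have K0 : 0 < K := lt_le_trans ltr01 K1.
have [t10 t11] := theta01 _ (ltn0Sn 0).
(* As long as [rho >= 1 / K], one has [(1 - theta 1) * rho >= 2 * e], so passing to
   [theta 1 * rho + e] lowers [rho] by at least [e]. *)
pose e := (1 - theta 1) / (2 * K).
have e0 : 0 < e by rewrite divr_gt0 ?subr_gt0 // mulr_gt0.
have e6 : 0 < e / 6 by rewrite divr_gt0.
have [n1 Hn1] := theta_null _ e6.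
pose n0 := n1.+1.
have alpha_le m n : (0 < m)%N -> (m <= n)%N -> Ole (alpha m) (alpha n).
  move=> m0; elim: n => [|n IH]; first by rewrite leqNgt m0.
  rewrite leq_eqVlt ltnS => /orP[/eqP->//|mn].
  by apply: Ole_trans (IH mn) (alpha_mono _ _); apply: leq_trans mn.
have alpha_a' n : Ole (alpha n) a'.
  case: n => [|n]; first exact: omax_ub_l.
  by apply: Ole_trans (omax_ub_r _ _); apply: (Ole_Lr (n := n)).
have alpha1 n : (0 < n)%N -> Ole (OS OZ) (alpha n) by move=> /alpha2/Olt_le.
have [b [c [ba ac]]] := omega_power_bracket (Ole_trans (alpha1 1%N isT) (alpha_a' 1%N)).
have [bH [cH [bHa aHc]]] := omega_power_bracket (alpha1 n0 isT).
have rk n : ~ tder_iter (omul (oexp omega b) (ofnat c.+1)) (family_tree (F n)) [::].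
  apply: iota_rank_lt (F_reg n) (F_iota n) _; exact: Ole_trans ac.
have rkH n : (0 < n < n0)%N ->
    ~ tder_iter (omul (oexp omega bH) (ofnat cH.+1)) (family_tree (F n)) [::].
  move=> /andP[n_gt0 nn0]; apply: iota_rank_lt (F_reg n) (F_iota n) _.
  by apply: Ole_trans aHc; apply: alpha_le => //; apply: ltnW.
have tsmall n : (n0 <= n)%N -> theta n <= e / 6.
  by move=> n0n; apply/ltW/Hn1/ltnW.
have [M attM] := attains_base F_hered F_S0 theta01 theta_dec theta_null N_MT T_l1
  e0 (ltn0Sn n1) rk tsmall.
(* The base costs at most [a'] times a power of [alpha n0], and each round multiplies the cost by at
   most another finite power of [alpha n0]. The total stays below [a'] times
   [oexp (alpha n0) omega]. *)
have chain k : exists delta rho j, [/\ 0 <= rho, attains F theta N T e n0 delta rho,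
    Ole delta (omul a' (oexp (alpha n0) (ofnat j))) & rho < K^-1 \/ rho <= 1 - k%:R * e].
  elim: k => [|k [delta [rho [j [rho0 att le_d rhoK]]]]].
    have [j Hj] := ofnat_le_expn M (alpha2 n0 isT).
    exists (omul (oexp omega b) (ofnat M)), 1, j; split=> //; first exact: omul_le ba Hj.
    by right; rewrite mul0r subr0.
  have [rhoK'|Krho] := ltP rho K^-1.
    by exists delta, rho, j; split=> //; left.
  have {rhoK} rhoK : rho <= 1 - k%:R * e by case: rhoK => // /lt_le_trans/(_ Krho); rewrite ltxx.
  have [M' att'] := attains_improve F_hered F_S0 theta01 theta_dec N_MT T_l1
    e0 (ltn0Sn n1) rho0 att rkH.
  have [j' Hj'] := ofnat_le_expn M' (alpha2 n0 isT).
  exists (omul delta (omul (oexp omega bH) (ofnat M'))), (theta 1 * rho + e), (j + j'.+1)%N.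
  split=> //.
  - by apply: addr_ge0; [apply: mulr_ge0 => //; apply: ltW|apply: ltW].
  - rewrite ofnatD oexpD [X in Ole _ X]omulA; apply: omul_le le_d _.
    by rewrite -oexp_ofnatS; apply: omul_le bHa Hj'.
  - right; rewrite -natr1 mulrDl mul1r.
    have Ee : (1 - theta 1) * K^-1 = 2 * e.
      by rewrite /e; field; rewrite gt_eqF.
    have : (1 - theta 1) * K^-1 <= (1 - theta 1) * rho.
      by apply: ler_wpM2l => //; rewrite subr_ge0 ltW.
    rewrite Ee; lra.
(* With [k * e >= 2] the alternative [rho <= 1 - k * e] would make [rho] negative. *)
have [k _ Hk] := large_multiple (ler0n R 2) e0.
have [delta [rho [j [rho0 att le_d rhoK]]]] := chain k.
have {}rhoK : rho < K^-1 by case: rhoK => //; lra.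
have Dd : tder_iter (oadd OZ delta) T s0.
  rewrite oadd0; apply: tder_iter_anti Ds; apply: Ole_trans le_d _; apply: omul_le2l.
  apply: (Ole_Lr (n := n1)); exact: (Ole_Lr (n := j)).
have [y [s' [[Ts' cy _ _ Ny] _]]] := att OZ s0 Dd.
have := cone_l1 T_l1 Ts' cy; rewrite mulr1 => KN.
by have := lt_le_trans (le_lt_trans Ny rhoK) KN; rewrite ltxx.
Qed.

(** * Lower estimate *)

Section Lower.
Variables (R : realType) (F : nat -> fam) (theta : nat -> R) (N : vec R -> R).
Hypothesis F_reg : forall n, regular (F n).
Hypothesis F_S0 : forall n, S0_sub (F n).
Hypothesis theta01 : forall n, (0 < n)%N -> 0 < theta n /\ theta n < 1.
Hypothesis theta_dec : forall n, (0 < n)%N -> theta n.+1 <= theta n.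
Hypothesis N_MT : MTnorm F theta N.

(** The bound [lo] allows a further block to be demanded as far to the right as needed. *)
Definition l1_unit_set (kappa : R) (lo : nat) (s : seq nat) : Prop :=
  [/\ sorted ltn s, forall k, k \in s -> (lo <= k)%N &
      forall a : vec R, kappa * \sum_(k <- s) `|a k| <= N (restrict s a)].

Lemma prefix_closed_l1_unit_set kappa lo :
  0 <= kappa -> prefix_closed (l1_unit_set kappa lo).
Proof.
move=> k0 s i [so slo sN]; split.
- exact: take_sorted.
- by move=> k /mem_take; apply: slo.
- move=> a; have := sN (restrict (take i s) a).
  have -> : restrict s (restrict (take i s) a) = restrict (take i s) a.
    apply: funext => k; rewrite /restrict; case: ifP => // ks; case: ifP => // /mem_take.
    by rewrite ks.
  apply: le_trans; apply: ler_wpM2l => //.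
  apply: (@le_trans _ _ (\sum_(k <- take i s ++ drop i s) `|restrict (take i s) a k|)).
    rewrite big_cat /=; apply: ler_wpDr; first exact: sumr_ge0.
    rewrite big_seq [leRHS]big_seq; apply: ler_sum => k ks.
    by rewrite /restrict ks.
  by rewrite cat_take_drop.
Qed.

Lemma sum_sorted_seq (s : seq nat) m (f : nat -> R) : sorted ltn s ->
  (forall k, k \in s -> (k < m)%N) ->
  \sum_(k <- s) f k = \sum_(k < m | (k : nat) \in s) f k.
Proof.
move=> so sm; rewrite -(big_mkord (fun k => k \in s) f) -big_filter.
congr bigop; apply: (irr_sorted_eq ltn_trans ltnn) => //.
  by apply: sorted_filter; [exact: ltn_trans|exact: iota_ltn_sorted].
move=> k; rewrite mem_filter mem_index_iota /=.
by case: (boolP (k \in s)) => // /sm->.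
Qed.

Lemma seq_bounded (s : seq nat) : exists m, forall k, k \in s -> (k < m)%N.
Proof.
exists (\sum_(k <- s) k.+1)%N => k ks.
by rewrite (big_rem k ks) /= leq_addr.
Qed.

Lemma finsupp_restrict_seq (s : seq nat) (a : vec R) : finsupp (restrict s a).
Proof.
have [m Hm] := seq_bounded s; exists m => k mk; rewrite /restrict; case: ifP => // /Hm.
by rewrite ltnNge mk.
Qed.

(** Spreading moves every new element past [lo], so cutting off at [lo] costs no rank. *)
Lemma F0_l1_unit_set xi lo s : tder_iter xi (family_tree (F 0)) s ->
  (forall k, k \in s -> (lo <= k)%N) -> tder_iter xi (l1_unit_set 1 lo) s.
Proof.
have [_ hF sF _] := F_reg 0.
elim: xi s => /= [|xi IH|f IH] s.
- move=> [so Fs] slo; split=> // a; rewrite mul1r.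
  have [m Hm] := seq_bounded s.
  apply: le_trans (N_ge_F0 N_MT m (finsupp_restrict_seq s a) Fs).
  rewrite (sum_sorted_seq _ so Hm); apply: ler_sum => k ks.
  by rewrite /restrict ks.
- move=> [Ds [k Dk]] slo; split; first exact: IH.
  have [m Hm] := seq_bounded s; pose l := maxn k (maxn m lo).
  have so : sorted ltn s by case: (tder_iter_sub Ds).
  exists l; apply: IH.
    apply: (spread_rcons _ Dk).
    + apply: spread_closed_tder_iter; first by move=> t [].
      exact: spread_closed_family_tree.
    + by rewrite sorted_rcons_ltn so; apply/allP => j /Hm; rewrite /l; lia.
    + by rewrite /l; lia.
  by move=> j; rewrite mem_rcons inE => /orP[/eqP->|/slo//]; rewrite /l; lia.
- by move=> Ds slo n; apply: IH.
Qed.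

Lemma sorted_flatten_blocks (ss : seq (seq nat)) :
  (forall u, u \in ss -> u != [::]) -> sorted ltn (flatten ss) -> blocks ss.
Proof.
elim: ss => // u ss IH ne; rewrite /= (sorted_pairwise ltn_trans) pairwise_cat.
case/and3P=> uss _; rewrite -(sorted_pairwise ltn_trans) => sss.
have /IH/(_ sss)/andP[ne' so'] : forall v, v \in ss -> v != [::].
  by move=> v vs; apply: ne; rewrite inE vs orbT.
apply/andP; split; first by rewrite /= ne' andbT ne ?mem_head.
rewrite /= path_min_sorted //; apply/allP => v vs.
apply/allP => j ju; apply/allP => k kv.
by apply: (allrelP uss) => //; apply/flattenP; exists v.
Qed.

(** The minima of the blocks form the set [t], so the blocks are admissible and lose only the factor
    [theta n]. Each derivative available at [t] permits one more block, and building that block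
    provides [gam] derivatives. *)
Lemma l1_unit_set_mul n gam kappa xi lo (t : seq nat) (ss : seq (seq nat)) :
  (0 < n)%N -> 0 <= kappa ->
  (forall lo', tder_iter gam (l1_unit_set kappa lo') [::]) ->
  tder_iter xi (family_tree (F n)) t -> map smin ss = t ->
  (forall u, u \in ss -> u != [::] /\ l1_unit_set kappa lo u) ->
  sorted ltn (flatten ss) ->
  tder_iter (omul gam xi) (l1_unit_set (theta n * kappa) lo) (flatten ss).
Proof.
move=> n0 k0 Hgam; have [tn _] := theta01 n0.
have [_ hF sF _] := F_reg n.
elim: xi t ss => /= [|xi IH|f IH] t ss.
- move=> [_ Ft] Et Hss so; split=> //.
    by move=> k /flattenP[u /Hss[_ [_ ulo _]] ku]; apply: ulo.
  move=> a.
  have aE : admissible (F n) ss.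
    split; first by apply: sorted_flatten_blocks so => u /Hss[].
    by rewrite Et.
  apply: le_trans (N_ge_adm N_MT (finsupp_restrict_seq _ a) n0 aE).
  rewrite -mulrA; apply: ler_wpM2l; first exact: ltW.
  rewrite big_flatten /= mulr_sumr big_seq [leRHS]big_seq; apply: ler_sum => u uss.
  have [_ [_ _ uN]] := Hss u uss; apply: le_trans (uN a) _.
  suff -> : restrict u (restrict (flatten ss) a) = restrict u a by [].
  apply: funext => k; rewrite /restrict; case: ifP => // ku.
  by have -> : k \in flatten ss by apply/flattenP; exists u.
- move=> [Dt [k Dk]] Et Hss so; apply/tder_iter_add; rewrite -[flatten ss]cats0.
  apply/tder_iter_at.
  have [m Hm] := seq_bounded (flatten ss).
  pose lo' := maxn k (maxn m lo).
  apply: tder_iter_mono (Hgam lo') => u [uo ulo uN].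
  (* An empty [u] is no block yet. A nonempty one already is: its minimum lies beyond [k] and beyond
     all earlier blocks, so by spreading it extends [t] in place of [k]. *)
  have [->|u0] := eqVneq u [::]; first by rewrite cats0; apply: IH Dt Et Hss so.
  have -> : flatten ss ++ u = flatten (rcons ss u) by rewrite flatten_rcons.
  have sml : (lo' <= smin u)%N by apply/ulo/smin_mem.
  apply: (IH (rcons t (smin u))).
  + apply: (spread_rcons _ Dk); last by apply: leq_trans sml; rewrite /lo'; lia.
      apply: spread_closed_tder_iter; first by move=> v [].
      exact: spread_closed_family_tree.
    rewrite sorted_rcons_ltn; apply/andP; split; first by case: (tder_iter_sub Dt).
    apply/allP => j; rewrite -Et => /mapP[v vss ->].
    have /Hm : smin v \in flatten ss.
      by apply/flattenP; exists v => //; apply: smin_mem; case: (Hss v vss).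
    by move: sml; rewrite /lo'; lia.
  + by rewrite map_rcons Et.
  + move=> v; rewrite mem_rcons inE => /orP[/eqP->|/Hss//]; split=> //; split=> //.
    by move=> j /ulo; rewrite /lo'; lia.
  + rewrite flatten_rcons (sorted_pairwise ltn_trans) pairwise_cat.
    rewrite -!(sorted_pairwise ltn_trans) so uo !andbT.
    by apply/allrelP => i j /Hm im /ulo; rewrite /lo'; lia.
- by move=> Dt Et Hss so j; apply: IH (Dt j) Et Hss so.
Qed.

Lemma l1_unit_set_pow alpha n k lo : (forall m, iota_is (F m) (alpha m)) ->
  (0 < n)%N ->
  tder_iter (omul (alpha 0) (oexp (alpha n) (ofnat k)))
    (l1_unit_set (theta n ^+ k) lo) [::].
Proof.
move=> F_iota n0; have [tn _] := theta01 n0.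
have iota0 m : tder_iter (alpha m) (family_tree (F m)) [::].
  apply: (cb_tder_iter (A := fun _ => false)) => //; exact/F_iota.
elim: k lo => [|k IH] lo; first by rewrite omul1 expr0; apply: F0_l1_unit_set.
rewrite exprS [oexp _ _]/= omulA.
apply: (l1_unit_set_mul (t := [::]) (ss := [::])) n0 _ IH _ _ _ _ => //.
by rewrite exprn_ge0 // ltW.
Qed.

Lemma l1_unit_set_tree kappa : 0 < kappa -> l1_tree N kappa^-1
  (fun v => exists2 s, l1_unit_set kappa 0 s & v = map (@evec R) s).
Proof.
move=> k0; split; last first.
  move=> v i [s Hs ->]; exists (take i s); last by rewrite map_take.
  by apply: prefix_closed_l1_unit_set Hs; apply: ltW.
move=> _ [s [so _ sN] ->]; rewrite /l1_block_node size_map.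
have us : uniq s := sorted_uniq ltn_trans ltnn so.
have nthE i : (i < size s)%N -> nth (zv R) (map (@evec R) s) i = evec R (nth 0%N s i).
  by move=> si; rewrite (nth_map 0%N).
split.
- move=> i si; rewrite nthE //; split; first exact: finsupp_evec.
  exact: N_evec F_S0 theta01 theta_dec N_MT _.
- move=> i j k si; rewrite !nthE ?(ltnW si) // => /evec_supp Hj /evec_supp Hk.
  have := sorted_ltn_nth ltn_trans 0%N so; move=> /(_ i i.+1).
  by rewrite !inE si (ltnW si) ltnSn => /(_ isT isT isT) /=; lia.
- move=> a; rewrite invrK; pose a' k := a (index k s).
  apply: le_trans (_ : kappa * \sum_(k <- s) `|a' k| <= _).
    rewrite (big_nth 0%N) big_mkord ler_pM2l //; apply: ler_sum => i _.
    by rewrite /a' index_uniq.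
  apply: le_trans (sN a') _.
  suff -> : restrict s a' =
      (fun k => \sum_(i < size s) a i * nth (zv R) (map (@evec R) s) i k) by [].
  apply: funext => k; rewrite /restrict.
  under eq_bigr => i _ do rewrite nthE // /evec.
  case: ifP => [ks|/negP ks].
    have si : (index k s < size s)%N by rewrite index_mem.
    rewrite (bigD1 (Ordinal si)) //= nth_index // eqxx mulr1 big1 ?addr0 // => i ii.
    rewrite (_ : (k == _) = false) ?mulr0 //; apply: contraNF ii => /eqP ki.
    by apply/eqP/val_inj; rewrite /= ki index_uniq.
  rewrite big1 // => i _; rewrite (_ : (k == _) = false) ?mulr0 //.
  by apply/negP => /eqP ki; apply: ks; rewrite ki mem_nth.
Qed.

Lemma Ib_lower alpha : (forall m, iota_is (F m) (alpha m)) ->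
  Ib_ge N (omul (alpha 0%N) (OL (fun n => oexp (alpha n.+1) omega))).
Proof.
(* Below both suprema, [d] is less than [alpha 0 * alpha n.+1 ^ k] for fixed [n] and [k], so one
   [k]-fold composition suffices. *)
move=> F_iota d /Olt_OL_inv[n /Olt_OL_inv[k dk]].
have [tn tn1] := theta01 (ltn0Sn n).
pose kappa := theta n.+1 ^+ k.
have k0 : 0 < kappa by rewrite exprn_gt0.
have HT := l1_unit_set_tree k0.
exists kappa^-1; eexists; split; last split; [|exact: HT|].
  by rewrite invf_ge1 //; apply: exprn_ile1; apply: ltW.
exists [::]; apply/treeD_iterE; first by case: HT.
have D := tder_iter_anti (Olt_le dk) (l1_unit_set_pow k 0 F_iota (ltn0Sn n)).
rewrite -[[::]]/(map (@evec R) [::]).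
elim: d {dk} [::] D => /= [|d IH|f IH] s.
- by exists s.
- move=> [/IH H1 [x /IH]]; rewrite map_rcons => H2.
  by split=> //; exists (evec R x).
- by move=> D m; apply: IH.
Qed.

End Lower.

(** * Ordinal arithmetic for the cases of the theorem *)

(** With [oexp omega b] the leading power of [a] and [oexp omega x] that of [b], the ordinal [w]
    satisfies [w <= a <= w ^ (d + 1)]. If no [alpha n.+1] reaches [w], then [a = w], which is
    excluded; otherwise [a] lies below a finite power of that [alpha n.+1]. *)
Lemma oexp_omega_sup_attained (alpha : nat -> Ord) (a := OL (fun n => alpha n.+1)) :
  (forall n, Olt (alpha n) a) -> (forall xi, ~ Oeq a (oexp omega (oexp omega xi))) ->
  exists n, (0 < n)%N /\ Ole (oexp a omega) (oexp (alpha n) omega).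
Proof.
move=> alpha_lt not_pow.
(* A supremum that is not attained is infinite; this rules out [b = 0] below. *)
have a_inf c : ~ Ole a (ofnat c).
  elim: c => [|c IH] ac.
    exact: Olt_Z_inv (Ole_trans (alpha_lt 0%N) ac).
  by apply: IH; apply: Ole_Ll => n; apply/Ole_SS_inv/(Ole_trans (alpha_lt n.+1) ac).
have a1 : Ole (OS OZ) a.
  by case: (OleVlt (OS OZ) a) => // /Ole_SS_inv/(a_inf 0%N).
have [b [c [ba ac]]] := omega_power_bracket a1.
have b1 : Ole (OS OZ) b.
  case: (OleVlt (OS OZ) b) => // /Ole_SS_inv b0; case: (a_inf c).
  apply: Ole_trans ac _; rewrite -[X in Ole _ X]omul1l; apply: omul_le2r.
  exact: (@oexp_le2l _ _ OZ).
have [x [d [xb bd]]] := omega_power_bracket b1.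
pose w := oexp omega (oexp omega x).
have [[n Hn]|no] := pselect (exists n, Ole w (alpha n.+1)); last first.
  case: (not_pow x); split; last by apply: Ole_trans ba; apply: oexp_le2l.
  apply: Ole_Ll => n; case: (OleVlt w (alpha n.+1)) => [H|]; last exact: Olt_le.
  by case: no; exists n.
exists n.+1; split=> //.
have aw : Ole a (oexp w (ofnat d.+1)).
  apply: Ole_trans ac _.
  apply: (@Ole_trans (oexp omega (OS b))); first exact: (Ole_Lr (n := c)).
  rewrite /w -oexpM; apply: oexp_le2l => //=.
  apply: (@Ole_trans (oadd b (OS OZ))); first by [].
  apply: Ole_trans (oadd_le2r _ bd) _; apply: oadd_le2l; exact: oexp_ge1.
apply: Ole_Ll => k.
apply: (@Ole_trans (oexp (alpha n.+1) (ofnat (d.+1 * k)))).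
  rewrite ofnatM oexpM; apply: oexp_le2r; apply: Ole_trans aw _; exact: oexp_le2r.
exact: (Ole_Lr (n := (d.+1 * k)%N)).
Qed.

Lemma Ib_le_mono (R : realType) (N : vec R -> R) g g' :
  Ole g g' -> Ib_le N g -> Ib_le N g'.
Proof.
move=> gg H K T K1 HT s; have [_ cT] := HT.
by rewrite treeD_iterE // => /(tder_iter_anti gg); rewrite -treeD_iterE //; apply: H K1 HT s.
Qed.

Lemma Ib_ge_mono (R : realType) (N : vec R -> R) g g' :
  Ole g' g -> Ib_ge N g -> Ib_ge N g'.
Proof. by move=> gg H d dg; apply: H; apply: Ole_trans gg. Qed.

Theorem theorem14 (R : realType) (F : nat -> fam) (theta : nat -> R)
    (alpha : nat -> Ord) (N : vec R -> R) :
  (forall n, regular (F n)) ->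
  (forall n, S0_sub (F n)) ->
  regular (fun A => exists n, F n A) ->
  (forall n, (0 < n)%N -> 0 < theta n /\ theta n < 1) ->
  (forall n, (0 < n)%N -> theta n.+1 <= theta n) ->
  (forall e : R, 0 < e -> exists M, forall n, (M <= n)%N -> theta n < e) ->
  (forall n, iota_is (F n) (alpha n)) ->
  (forall n, (0 < n)%N -> Olt (ofnat 1) (alpha n)) ->
  (forall n, (0 < n)%N -> Ole (alpha n) (alpha n.+1)) ->
  MTnorm F theta N ->
  let a := OL (fun n => alpha n.+1) in
  let s := OL (fun n => oexp (alpha n.+1) omega) in
  [/\ Ib_ge N (omul (alpha 0%N) s) /\ Ib_le N (omul (omax (alpha 0%N) a) s),
      Ole a (alpha 0%N) -> Ib_eq N (omul (alpha 0%N) s),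
      Olt (alpha 0%N) a -> (exists n, (0 < n)%N /\ Oeq a (alpha n)) -> Ib_eq N (oexp a omega)
    & (forall n, Olt (alpha n) a) ->
      (forall xi, ~ Oeq a (oexp omega (oexp omega xi))) -> Ib_eq N (oexp a omega)].
Proof.
move=> F_reg F_S0 _ theta01 theta_dec theta_null F_iota alpha2 alpha_mono N_MT a s.
have lower : Ib_ge N (omul (alpha 0%N) s).
  exact (Ib_lower F_reg F_S0 theta01 theta_dec N_MT F_iota).
have upper : Ib_le N (omul (omax (alpha 0%N) a) s).
  exact (Ib_upper F_reg F_S0 theta01 theta_dec theta_null F_iota alpha2 alpha_mono N_MT).
(* Index zero would reduce [F 0] to the empty set, but it contains singletons. *)
have alpha0_ge1 : Ole (OS OZ) (alpha 0%N).
  case: (OleVlt (OS OZ) (alpha 0%N)) => // /Ole_SS_inv a0.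
  have S0 : family_tree (F 0) [:: 0%N].
    split=> //; have [_ hF _ _] := F_reg 0%N.
    by apply: hF ((F_S0 0%N).2 0%N) _ => k; rewrite inE.
  have := tder_iter_cb (b := alpha 0%N) (F_reg 0%N) (tder_iter_anti (b := OZ) a0 S0).
  by move=> /F_iota /(_ 0%N).
have sa : Ole s (oexp a omega).
  by apply: Ole_Ll => n; apply: oexp_le2r; apply: (Ole_Lr (n := n)).
(* Cases (3) and (4) share this: [a ^ omega] is at most a member of the supremum [s], and
   [s <= a ^ omega], so both bounds of (1) become [a ^ omega]. *)
have attained : Ole (alpha 0%N) a ->
    (exists n, (0 < n)%N /\ Ole (oexp a omega) (oexp (alpha n) omega)) ->
    Ib_eq N (oexp a omega).
  move=> a0a [[|n] [] // _ an]; split.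
    apply: Ib_le_mono upper; apply: Ole_trans (omul_oexp_omega a).
    by apply: omul_le sa; apply: omax_lub.
  apply: Ib_ge_mono lower; apply: Ole_trans an _.
  apply: Ole_trans (Ole_omull s alpha0_ge1).
  exact: (Ole_OL (fun n => oexp (alpha n.+1) omega) n).
split=> //.
- move=> aa0; split=> //; apply: Ib_le_mono upper; apply: omul_le2r; exact: omax_lub.
- move=> /Olt_le a0a [n [n0 [an _]]]; apply: attained => //.
  by exists n; split=> //; apply: oexp_le2r.
- move=> alpha_lt not_pow; apply: attained; first exact/Olt_le/alpha_lt.
  exact: oexp_omega_sup_attained.
Qed.
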